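(* Fix $k\ge1$ and a $k$-tuple of skew shapes $\boldsymbol\mu$ of total size $n$, and let $\mathrm{Des}(\mathbf{T})=\{j:\sigma(\mathbf{T})_j=-1\}$ for $\mathbf{T}\in\mathrm{SYT}(\boldsymbol\mu)$. Then the involutions $\{D_i\}_{1<i<n}$ form a weak dual equivalence for $(\mathrm{SYT}(\boldsymbol\mu),\mathrm{Des})$, and when $k\le2$ they form a dual equivalence for $(\mathrm{SYT}(\boldsymbol\mu),\mathrm{Des})$.
   Context: Diagrams use French convention: a cell $(a,b)$ ($a$ column, $b$ row), content $c(a,b)=a-b$; skew shapes $\lambda/\mu$ are set differences of partition diagrams, not identified up to translation. $\boldsymbol\mu=(\mu^{(0)},\dots,\mu^{(k-1)})$; $\mathrm{SYT}(\boldsymbol\mu)$ is the set of bijections from the (disjoint union of) cells to $[n]$ increasing along rows and up columns in each component. Shifted content of a cell $x$ of $\mu^{(i)}$: $\tilde c(x)=k\,c(x)+i$. Content reading word $w(\mathbf{T})$: entries in increasing shifted content, equal shifted content read southwest to northeast. $\sigma(\mathbf{T})\in\{\pm1\}^{n-1}$: $\sigma_j=+1$ iff $j$ is left of $j+1$ in $w(\mathbf{T})$. $\mathrm{dist}(a,b)$ = absolute difference of the shifted contents of the cells of entries $a,b$; $\mathrm{dist}(i-1,i,i+1)$ = maximum pairwise distance. $d_i(w)$: identity if $i$ lies positionally between $i-1,i+1$; else swap $i$ with the farther of $i\pm1$. $\tilde d_i(w)$: identity if $i$ lies between; else, writing $abc$ for the subword of $i-1,i,i+1$ in positional order, replace it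 in the same positions by $bca$ if $a=i$, by $cab$ if $c=i$. $D_i(\mathbf{T})$ is the filling of the same cells with reading word $d_i(w(\mathbf{T}))$ if $\mathrm{dist}(i-1,i,i+1)>k$, and $\tilde d_i(w(\mathbf{T}))$ otherwise. For $D\subseteq[m-1]$, $Q_D(X)=\sum x_{i_1}\cdots x_{i_m}$ over $i_1\le\dots\le i_m$ with $i_j<i_{j+1}$ for $j\in D$. Given a finite set $\mathcal{A}$, $\mathrm{Des}(T)\subseteq[n-1]$, involutions $\varphi_2,\dots,\varphi_{n-1}$, for $1<h\le i<n$ let $[T]_{h,i}$ be the class of $T$ under the relation generated by $\varphi_h,\dots,\varphi_i$ and $\mathrm{Des}_{h,i}(U)=\{d-(h-2):d\in\mathrm{Des}(U)\cap\{h-1,\dots,i\}\}\subseteq[i-h+2]$. The family is a weak dual equivalence if (i) for all $1<h\le i<n$ with $i-h\le3$ and all $T$, $\sum_{U\in[T]_{h,i}}Q_{\mathrm{Des}_{h,i}(U)}(X)$ (degree $i-h+3$) is a nonnegative integer combination of Schur functions, and is a single Schur function when $h=i$; (ii) $\varphi_i\varphi_j=\varphi_j\varphi_i$ for $|i-j|\ge3$. It is a dual equivalence if moreover in (i) the sum is a single Schur function $s_\lambda$ ($\lambda$ a partition of $i-h+3$) for all such $h\le i$. *)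

(* Defs.v *)
From HB Require Import structures.
From mathcomp Require Import all_boot all_order all_algebra.
Set Implicit Arguments.
Unset Strict Implicit.
Unset Printing Implicit Defensive.

(* A cell is a pair (a, b) : a = column, b = row, both 0-indexed;      *)
(* the bottom row is row 0.  Content c(a,b) = a - b.                   *)

Definition is_partition (s : seq nat) : bool :=
  sorted geq s && all (fun x => 0 < x) s.

Definition diagram (la : seq nat) : seq (nat * nat) :=
  flatten [seq [seq (a, b) | a <- iota 0 (nth 0 la b)] | b <- iota 0 (size la)].

Definition is_skew_shape (s : seq nat * seq nat) : bool :=
  [&& is_partition s.1, is_partition s.2 &
      all (fun c => c \in diagram s.1) (diagram s.2)].

Definition skew_cells (s : seq nat * seq nat) : seq (nat * nat) :=
  [seq c <- diagram s.1 | c \notin diagram s.2].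

(* A cell of the disjoint union is (i, (a, b)) with i the component.   *)
(* A filling is stored as the list of its entries, the p-th entry      *)
(* being the entry of the p-th cell of [cells_of mu].                  *)

Definition cells_of (k : nat) (mu : 'I_k -> seq nat * seq nat)
  : seq (nat * (nat * nat)) :=
  flatten [seq [seq (val i, c) | c <- skew_cells (mu i)] | i <- enum 'I_k].

Definition cell0 : nat * (nat * nat) := (0, (0, 0)).

Definition is_standard (k : nat) (mu : 'I_k -> seq nat * seq nat)
  (t : seq nat) : bool :=
  let cs := cells_of mu in
  let n := size cs in
  perm_eq t (iota 1 n) &&
  all (fun p => all (fun q =>
        let x := nth cell0 cs p in
        let y := nth cell0 cs q in
        (x.1 == y.1) ==>
        ((((x.2.2 == y.2.2) && (x.2.1 < y.2.1)) ||
          ((x.2.1 == y.2.1) && (x.2.2 < y.2.2))) ==>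
         (nth 0 t p < nth 0 t q)))
      (iota 0 n)) (iota 0 n).

Definition SYT (k : nat) (mu : 'I_k -> seq nat * seq nat) : seq (seq nat) :=
  [seq t <- permutations (iota 1 (size (cells_of mu))) | is_standard mu t].

Definition scont (k : nat) (x : nat * (nat * nat)) : int :=
  (k%:Z * (x.2.1%:Z - x.2.2%:Z) + x.1%:Z)%R.

(* cells (as indices into cells_of mu) in reading order: increasing shifted
   content, equal shifted content read southwest to northeast *)
Definition read_order (k : nat) (mu : 'I_k -> seq nat * seq nat) : seq nat :=
  let cs := cells_of mu in
  sort (fun p q =>
          let x := nth cell0 cs p in
          let y := nth cell0 cs q in
          (scont k x < scont k y)%R ||
          ((scont k x == scont k y) && (x.2.2 <= y.2.2)))
       (iota 0 (size cs)).

Definition rword (k : nat) (mu : 'I_k -> seq nat * seq nat) (t : seq nat)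
  : seq nat :=
  [seq nth 0 t p | p <- read_order mu].

Definition of_word (k : nat) (mu : 'I_k -> seq nat * seq nat) (w : seq nat)
  : seq nat :=
  [seq nth 0 w (index p (read_order mu)) | p <- iota 0 (size (cells_of mu))].

Definition sigma_pos (k : nat) (mu : 'I_k -> seq nat * seq nat)
  (t : seq nat) (j : nat) : bool :=
  index j (rword mu t) < index j.+1 (rword mu t).

Definition DesSYT (k : nat) (mu : 'I_k -> seq nat * seq nat) (t : seq nat)
  : pred nat :=
  fun j => (0 < j < size (cells_of mu)) && ~~ sigma_pos mu t j.

Definition cell_of (k : nat) (mu : 'I_k -> seq nat * seq nat) (t : seq nat)
  (a : nat) : nat * (nat * nat) :=
  nth cell0 (cells_of mu) (index a t).

Definition dist (k : nat) (mu : 'I_k -> seq nat * seq nat) (t : seq nat)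
  (a b : nat) : nat :=
  absz (scont k (cell_of mu t a) - scont k (cell_of mu t b))%R.

Definition dist3 (k : nat) (mu : 'I_k -> seq nat * seq nat) (t : seq nat)
  (i : nat) : nat :=
  maxn (dist mu t i.-1 i) (maxn (dist mu t i i.+1) (dist mu t i.-1 i.+1)).

Definition ndist (m n : nat) : nat := (m - n) + (n - m).

Definition between (i : nat) (w : seq nat) : bool :=
  let p := index i w in
  let pm := index i.-1 w in
  let pp := index i.+1 w in
  ((pm < p) && (p < pp)) || ((pp < p) && (p < pm)).

Definition swapv (x y : nat) (w : seq nat) : seq nat :=
  [seq if z == x then y else if z == y then x else z | z <- w].

Definition d_op (i : nat) (w : seq nat) : seq nat :=
  if between i w then w else
  let p := index i w in
  if ndist p (index i.+1 w) < ndist p (index i.-1 w)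
  then swapv i i.-1 w else swapv i i.+1 w.

(* tilde d_i : abc -> bca if a = i, abc -> cab if c = i *)
Definition dt_op (i : nat) (w : seq nat) : seq nat :=
  if between i w then w else
  let vs := sort (fun x y => index x w <= index y w) [:: i.-1; i; i.+1] in
  let a := nth 0 vs 0 in
  let b := nth 0 vs 1 in
  let c := nth 0 vs 2 in
  if a == i then
    [seq if z == a then b else if z == b then c else if z == c then a else z
    | z <- w]
  else
    [seq if z == a then c else if z == b then a else if z == c then b else z
    | z <- w].

Definition D_op (k : nat) (mu : 'I_k -> seq nat * seq nat) (i : nat)
  (t : seq nat) : seq nat :=
  let w := rword mu t in
  of_word mu (if k < dist3 mu t i then d_op i w else dt_op i w).

(* Fundamental quasisymmetric functions and Schur functions,          *)
(* represented by their coefficient functions: for every N, the      *)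
(* coefficient of the monomial x_0^{a_0} ... x_{N-1}^{a_{N-1}}.        *)

Definition Qcoef (m : nat) (D : pred nat) (N : nat) (a : 'I_N -> nat) : nat :=
  #|[set f : {ffun 'I_m -> 'I_N} |
      [forall p : 'I_m, forall q : 'I_m,
         (val q == (val p).+1) ==> ((f p <= f q) && (D (val q) ==> (f p < f q)))]
      && [forall x : 'I_N, #|[pred p : 'I_m | f p == x]| == a x]]|.

(* coefficient of x^a in s_la : number of semistandard tableaux of shape la
   (French: weakly increasing along rows, strictly increasing up columns)
   with content a; the cells of la are indexed by their position in
   [diagram la] *)
Definition schur_coef (la : seq nat) (N : nat) (a : 'I_N -> nat) : nat :=
  let cs := diagram la in
  #|[set f : {ffun 'I_(size cs) -> 'I_N} |
      [forall p : 'I_(size cs), forall q : 'I_(size cs),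
         ((((nth (0,0) cs p).2 == (nth (0,0) cs q).2) &&
           ((nth (0,0) cs p).1 < (nth (0,0) cs q).1)) ==> (f p <= f q)) &&
         ((((nth (0,0) cs p).1 == (nth (0,0) cs q).1) &&
           ((nth (0,0) cs p).2 < (nth (0,0) cs q).2)) ==> (f p < f q))]
      && [forall x : 'I_N, #|[pred p | f p == x]| == a x]]|.

Arguments Qcoef m D N a : clear implicits.
Arguments schur_coef la N a : clear implicits.

Definition schur_positive (m : nat) (F : forall N, ('I_N -> nat) -> nat) : Prop :=
  exists L : seq (seq nat),
    all (fun la => is_partition la && (sumn la == m)) L /\
    forall N (a : 'I_N -> nat), F N a = \sum_(la <- L) schur_coef la N a.

Definition is_schur (m : nat) (F : forall N, ('I_N -> nat) -> nat) : Prop :=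
  exists la : seq nat, is_partition la /\ sumn la = m /\
    forall N (a : 'I_N -> nat), F N a = schur_coef la N a.

Section DualEq.
Variable T : choiceType.

Definition involutive_family (n : nat) (A : seq T) (phi : nat -> T -> T) : Prop :=
  forall i, 1 < i < n -> forall x, x \in A -> phi i x \in A /\ phi i (phi i x) = x.

Definition gen_rel (A : seq T) (phi : nat -> T -> T) (h i : nat)
  : rel (seq_sub A) :=
  fun x y => has (fun j => (phi j (ssval x) == ssval y) ||
                           (phi j (ssval y) == ssval x)) (index_iota h i.+1).

Definition Des_hi (Des : T -> pred nat) (h i : nat) (U : T) : pred nat :=
  fun d => (0 < d <= i - h + 2) && Des U (d + h - 2).

Definition class_Q (A : seq T) (Des : T -> pred nat) (phi : nat -> T -> T)
  (h i : nat) (x : seq_sub A) : forall N, ('I_N -> nat) -> nat :=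
  fun N a => \sum_(y : seq_sub A | connect (@gen_rel A phi h i) x y)
               Qcoef (i - h + 3) (Des_hi Des h i (ssval y)) N a.

Definition weak_dual_equivalence (n : nat) (A : seq T) (Des : T -> pred nat)
  (phi : nat -> T -> T) : Prop :=
  involutive_family n A phi /\
  (forall h i, 1 < h -> h <= i -> i < n -> i - h <= 3 ->
     forall x : seq_sub A,
       schur_positive (i - h + 3) (class_Q Des phi h i x) /\
       (h = i -> is_schur (i - h + 3) (class_Q Des phi h i x))) /\
  (forall i j, 1 < i < n -> 1 < j < n -> 3 <= ndist i j ->
     forall x, x \in A -> phi i (phi j x) = phi j (phi i x)).

Definition dual_equivalence (n : nat) (A : seq T) (Des : T -> pred nat)
  (phi : nat -> T -> T) : Prop :=
  weak_dual_equivalence n A Des phi /\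
  (forall h i, 1 < h -> h <= i -> i < n -> i - h <= 3 ->
     forall x : seq_sub A, is_schur (i - h + 3) (class_Q Des phi h i x)).

End DualEq.

(* Main.v *)
(* Encode a standard filling by the sequence u of reading positions of its
   entries 1, 2, ..., n.  On u the operator D_i is a local move of the three
   terms u_{i-1}, u_i, u_{i+1}: if u_i is not their median, it depends only on
   their relative order and on whether the two extreme cells are at distance
   more than k.  Hence the class of T under D_h, ..., D_i is determined by the
   pattern of m = i - h + 3 <= 6 consecutive terms of u and by which pairs of
   the corresponding m sorted shifted contents differ by more than k.  There
   are finitely many such data, and for each of them the classes are computed
   and decomposed into descent multisets of standard Young tableaux, which
   represent Schur functions by standardization.

   A class can fail to be a single Schur function only if four cells have
   shifted contents within k of each other.  For k = 2 this forces two cells to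
   have equal shifted content, and such cells are separated, in the order of
   the entries, by cells of shifted content k less and k more; the patterns
   satisfying this condition give single Schur functions.  The case k = 1
   reduces to k = 2 by doubling the contents. *)

Require Import Defs.
From HB Require Import structures.
From mathcomp Require Import all_boot all_order all_algebra.
From mathcomp Require Import all_fingroup zify.
Set Implicit Arguments.
Unset Strict Implicit.
Unset Printing Implicit Defensive.

Import Order.TTheory GRing.Theory Num.Theory.

(** * Standardization and P-partitions *)

(** Reading positions form the inverse of the reading word, so the values [i-1], [i], [i+1] become
    three adjacent places, and [D_h, ..., D_i] act inside one window of the list. Positions follow
    increasing shifted content, so the maximum distance in [D_i] is that of the two extreme
    positions. This removes the shapes and the size of [k] from the combinatorics and leaves a
    threshold relation on pairs of positions.

    The price is that standardness is forgotten: the check runs over all permutations of a window,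
    whether or not they come from a filling. This is harmless for Schur positivity, which is
    verified for all of them. For [k <= 2], in windows with four close cells, single Schur functions
    are certified only for words that keep one trace of standardness, the predicate [admissible].

    The search and the greedy decomposition are proved sound, never complete: closure of a class and
    exhaustion of its descent codes are tested by the computation itself. *)

Fixpoint dcode (u : seq nat) : seq bool :=
  if u is x :: u' then
    if u' is y :: _ then (y < x) :: dcode u' else [::]
  else [::].

(** Codes are indexed from 0 and descents from 1, hence the predecessor; [Qcoef] evaluates its
    descent set at successors only. *)
Definition des_of (c : seq bool) : pred nat := fun j => nth false c j.-1.

Lemma nth_dcode u j : j.+1 < size u ->
  nth false (dcode u) j = (nth 0 u j.+1 < nth 0 u j).
Proof.
elim: u j => [|x [|y u] IH] [|j] //= lt_ju.
by rewrite (IH j).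
Qed.

Section LinearOrder.
Variables (m : nat) (lt : rel 'I_m).
Hypothesis lt_irr : irreflexive lt.
Hypothesis lt_tr : transitive lt.
Hypothesis lt_total : forall p q, p != q -> lt p q || lt q p.

Definition lrank (p : 'I_m) : nat := #|[pred q | lt q p]|.

Lemma lrank_lt p q : lt p q -> lrank p < lrank q.
Proof.
move=> pq; apply: proper_card; apply/properP; split.
  by apply/subsetP => r; rewrite !inE => /lt_tr; apply.
by exists p; rewrite !inE // lt_irr.
Qed.

Lemma lrank_bound p : lrank p < m.
Proof.
rewrite -[X in _ < X]card_ord -cardsT; apply: proper_card.
apply/properP; split; first by apply/subsetP.
by exists p; rewrite !inE // lt_irr.
Qed.

Definition lrank_ord p := Ordinal (lrank_bound p).

Lemma lrank_ord_inj : injective lrank_ord.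
Proof.
move=> p q /(congr1 val) /= e; apply/eqP/negPn/negP => /lt_total /orP[] /lrank_lt.
  by rewrite e ltnn.
by rewrite e ltnn.
Qed.

(** Ranks are injective from ['I_m] to itself, hence a permutation, whose inverse lists the elements
    in increasing order. *)
Lemma sorting_perm_exists :
  exists s : 'S_m, forall i j : 'I_m, i < j -> lt (s i) (s j).
Proof.
pose r := perm lrank_ord_inj.
exists r^-1%g => i j lt_ij.
have nij : r^-1%g i != r^-1%g j.
  by rewrite (inj_eq perm_inj); apply: contraTneq lt_ij => ->; rewrite ltnn.
case/orP: (lt_total nij) => // /lrank_lt.
have rE k : lrank (r^-1%g k) = k by have /(congr1 val) := permKV r k; rewrite permE.
by rewrite !rE ltnNge (ltnW lt_ij).
Qed.

Lemma sorting_perm_rank (s : 'S_m) :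
  (forall i j : 'I_m, i < j -> lt (s i) (s j)) -> forall i, lrank (s i) = i.
Proof.
move=> smon i; rewrite /lrank.
have -> : #|[pred q | lt q (s i)]| = #|[set j : 'I_m | j < i]|.
  rewrite -[RHS](card_imset _ (@perm_inj _ s)); apply: eq_card => q.
  rewrite !inE; apply/idP/imsetP => [qi|[j]]; last by rewrite inE => ji ->; apply: smon.
  exists (s^-1%g q); rewrite ?permKV // inE ltnNge leq_eqVlt.
  apply/negP => /orP[/eqP/val_inj e|lt_iq].
    by move: qi; rewrite e permKV lt_irr.
  have := smon _ _ lt_iq; rewrite permKV => /(lt_tr qi).
  by rewrite lt_irr.
have -> : [set j : 'I_m | j < i] = [set widen_ord (ltnW (ltn_ord i)) j | j in 'I_i].
  apply/setP => j; rewrite inE; apply/idP/imsetP => [ji|[k _ ->]]; last exact: (ltn_ord k).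
  by exists (Ordinal ji) => //; apply: val_inj.
rewrite card_imset ?card_ord // => x y /(congr1 val) /= e.
exact: val_inj.
Qed.

Lemma sorting_perm_unique (s s' : 'S_m) :
  (forall i j : 'I_m, i < j -> lt (s i) (s j)) ->
  (forall i j : 'I_m, i < j -> lt (s' i) (s' j)) -> s = s'.
Proof.
move=> /sorting_perm_rank sr /sorting_perm_rank sr'; apply/permP => i.
by apply: lrank_ord_inj; apply: val_inj => /=; rewrite sr sr'.
Qed.

End LinearOrder.

Section PPartition.
Variables (m N : nat) (a : 'I_N -> nat) (R : rel 'I_m) (lab : 'I_m -> nat).
Hypothesis lab_inj : injective lab.
Hypothesis R_irr : irreflexive R.

(** The standardization order: ties between equal values are broken by the labels. *)
Definition lexlt (f : {ffun 'I_m -> 'I_N}) : rel 'I_m :=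
  fun p q => (f p < f q) || ((f p == f q) && (lab p < lab q)).

Lemma lexlt_irr f : irreflexive (lexlt f).
Proof. by move=> p; rewrite /lexlt !ltnn andbF. Qed.

Lemma lexlt_tr f : transitive (lexlt f).
Proof.
move=> q p r; rewrite /lexlt => /orP[pq|/andP[/eqP-> pq]] /orP[qr|/andP[/eqP<- qr]].
- by rewrite (ltn_trans pq qr).
- by rewrite pq.
- by rewrite qr.
- by rewrite (ltn_trans pq qr) eqxx orbT.
Qed.

Lemma lexlt_total f p q : p != q -> lexlt f p q || lexlt f q p.
Proof.
move=> npq; rewrite /lexlt; case: (ltngtP (f p) (f q)) => [||/val_inj ->] //; rewrite ?orbT //.
by rewrite eqxx /= -neq_ltn; apply: contra npq => /eqP /lab_inj ->.
Qed.

Definition respects (f : {ffun 'I_m -> 'I_N}) : bool :=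
  [forall p, forall q, R p q ==>
     (if lab q < lab p then f p < f q else f p <= f q)].

Definition has_content (f : {ffun 'I_m -> 'I_N}) : bool :=
  [forall x : 'I_N, #|[pred p : 'I_m | f p == x]| == a x].

Definition linear_extension (s : 'S_m) : bool :=
  [forall p, forall q, R p q ==> (s^-1%g p < s^-1%g q)].

Definition sorts (f : {ffun 'I_m -> 'I_N}) (s : 'S_m) : bool :=
  [forall i : 'I_m, forall j : 'I_m, (i < j) ==> lexlt f (s i) (s j)].

Lemma sortsP f (s : 'S_m) : reflect (forall i j : 'I_m, i < j -> lexlt f (s i) (s j)) (sorts f s).
Proof.
apply: (iffP forallP) => [H i j|H i]; first by move/forallP/(_ j)/implyP: (H i).
by apply/forallP => j; apply/implyP; apply: H.
Qed.

Lemma sortsE f (s : 'S_m) p q : sorts f s -> (s^-1%g p < s^-1%g q) = lexlt f p q.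
Proof.
move/sortsP => H; case: (ltngtP (s^-1%g p) (s^-1%g q)) => [/H|/H|/val_inj e].
- by rewrite !permKV.
- rewrite !permKV => qp; apply/esym/negbTE/negP => pq.
  by have := lexlt_tr pq qp; rewrite lexlt_irr.
- by rewrite -(permKV s p) e permKV lexlt_irr.
Qed.

(** For [R p q], the inequality imposed on [f p] and [f q], strict when the labels descend and weak
    otherwise, is exactly [lexlt f p q]. *)
Lemma respects_sorts f (s : 'S_m) : sorts f s -> respects f = linear_extension s.
Proof.
move=> srt; apply: eq_forallb => p; apply: eq_forallb => q.
case Rpq: (R p q) => //=; rewrite (sortsE _ _ srt) /lexlt.
have [ltl|lel] := ltnP (lab q) (lab p).
  by rewrite (ltnNge (lab p)) (ltnW ltl) andbF orbF.
have npq : p != q by apply: contraTneq Rpq => ->; rewrite R_irr.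
have ltl : lab p < lab q.
  by rewrite ltn_neqAle lel andbT (inj_eq lab_inj).
by rewrite ltl andbT leq_eqVlt orbC.
Qed.

Definition perm_code (s : 'S_m) : seq bool :=
  dcode [seq lab (s i) | i <- enum 'I_m].

Lemma nth_perm_code (s : 'S_m) (p q : 'I_m) : val q = p.+1 ->
  des_of (perm_code s) q = (lab (s q) < lab (s p)).
Proof.
move=> e; rewrite /des_of /perm_code e succnK nth_dcode; last first.
  by rewrite size_map size_enum_ord -e ltn_ord.
have nE (i : 'I_m) : nth 0 [seq lab (s j) | j <- enum 'I_m] i = lab (s i).
  by rewrite (nth_map i) ?size_enum_ord ?ltn_ord // nth_ord_enum.
by rewrite -e !nE.
Qed.

(** By transitivity neighbouring places suffice, and there [lexlt] is a weak inequality that turns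
    strict at a label descent: the summation condition of [Qcoef]. *)
Lemma sorts_adjacent f (s : 'S_m) : sorts f s =
  [forall p : 'I_m, forall q : 'I_m, (val q == (val p).+1) ==>
     ((f (s p) <= f (s q)) && (des_of (perm_code s) (val q) ==> (f (s p) < f (s q))))].
Proof.
have adj (p q : 'I_m) : val q = p.+1 -> lexlt f (s p) (s q) =
    ((f (s p) <= f (s q)) && (des_of (perm_code s) (val q) ==> (f (s p) < f (s q)))).
  move=> e; rewrite (nth_perm_code s e) /lexlt.
  have npq : s p != s q by rewrite (inj_eq perm_inj) -(inj_eq val_inj) e -[_ == _]/(_ == _ :> nat) neq_ltn leqnn.
  have [ltl|lel] := ltnP (lab (s q)) (lab (s p)).
    rewrite (ltnNge (lab (s p))) (ltnW ltl) andbF orbF /=.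
    by case: ltngtP.
  have -> : lab (s p) < lab (s q) by rewrite ltn_neqAle lel andbT (inj_eq lab_inj).
  by rewrite andbT /= andbT [RHS]leq_eqVlt orbC.
apply/sortsP/forallP => [H p|H].
  apply/forallP => q; apply/implyP => /eqP e; rewrite -adj //.
  by apply: H; rewrite [X in _ < X]e.
have {}H (p q : 'I_m) : val q = p.+1 -> lexlt f (s p) (s q).
  by move=> e; rewrite adj //; have /forallP/(_ q)/implyP := H p; apply; apply/eqP.
move=> i j lt_ij; have := subnKC lt_ij; move: (j - i.+1) => d.
elim: d j {lt_ij} => [|d IH] j e; first by apply: H; rewrite -[val j]e addn0.
have lt_m : i.+1 + d < m by apply: leq_trans (ltn_ord j); rewrite -e addnS.
apply: lexlt_tr (IH (Ordinal lt_m) erefl) _.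
by apply: H; rewrite -[val j]e addnS.
Qed.

Lemma card_sorts (s : 'S_m) :
  #|[set f : {ffun 'I_m -> 'I_N} | sorts f s && has_content f]|
  = Qcoef m (des_of (perm_code s)) N a.
Proof.
pose h (f : {ffun 'I_m -> 'I_N}) := [ffun j => f (s j)].
have h_inj : injective h.
  move=> f g /ffunP e; apply/ffunP => i.
  by have := e (s^-1%g i); rewrite !ffunE permKV.
rewrite /Qcoef -(card_imset _ h_inj); apply: eq_card => g; rewrite inE.
have content f : has_content f = [forall x, #|[pred p : 'I_m | h f p == x]| == a x].
  apply: eq_forallb => x; congr (_ == _).
  rewrite -[RHS](card_imset _ (@perm_inj _ s)); apply: eq_card => p; rewrite !inE.
  apply/idP/imsetP => [fp|[q]]; last by rewrite !inE ffunE => fq ->.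
  by exists (s^-1%g p); rewrite ?permKV // inE ffunE permKV.
apply/imsetP/andP => [[f]|[g1 g2]].
  rewrite inE sorts_adjacent => /andP[f1 f2] ->; split; last by rewrite -content.
  apply/forallP => p; apply/forallP => q.
  by rewrite !ffunE; move/forallP/(_ p)/forallP: f1.
pose f := [ffun j => g (s^-1%g j)] : {ffun 'I_m -> 'I_N}.
have hf : h f = g by apply/ffunP => i; rewrite !ffunE permK.
exists f => //; rewrite inE content hf g2 andbT sorts_adjacent.
apply/forallP => p; apply/forallP => q; rewrite !ffunE !permK.
by move/forallP/(_ p)/forallP: g1.
Qed.

(** Stanley's fundamental theorem on (P, omega)-partitions: every [f] is sorted by exactly one
    permutation, and those sorted by a given linear extension are counted by one fundamental
    quasisymmetric function. *)
Theorem ppartition :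
  #|[set f : {ffun 'I_m -> 'I_N} | respects f && has_content f]|
  = \sum_(s : 'S_m | linear_extension s) Qcoef m (des_of (perm_code s)) N a.
Proof.
pose F := [set f : {ffun 'I_m -> 'I_N} | respects f && has_content f].
have one f : \sum_(s : 'S_m) (sorts f s : nat) = 1.
  have [s0 /sortsP s0P] := sorting_perm_exists (@lexlt_irr f) (@lexlt_tr f) (@lexlt_total f).
  rewrite (bigD1 s0) //= s0P big1 // => s ns.
  apply/eqP; rewrite eqb0; apply: contra ns => /sortsP sP; apply/eqP.
  by apply: (sorting_perm_unique (@lexlt_irr f) (@lexlt_tr f) (@lexlt_total f) sP); apply/sortsP.
rewrite -sum1_card; under eq_bigr => f _ do rewrite -(one f).
rewrite exchange_big /= [RHS]big_mkcond /=; apply: eq_bigr => s _.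
case: ifP => lin.
  rewrite -card_sorts -sum1_card big_mkcond [RHS]big_mkcond /=.
  apply: eq_bigr => f _; rewrite !inE.
  case srt: (sorts f s); last by case: ifP.
  by rewrite (respects_sorts srt) lin.
apply: big1 => f; rewrite inE => /andP[resp _].
by apply/eqP; rewrite eqb0; apply: contraFN lin => srt; rewrite -(respects_sorts srt).
Qed.

End PPartition.

(** * Expansion of Schur functions over standard Young tableaux *)

Lemma mem_diagram la c : (c \in diagram la) = (c.1 < nth 0 la c.2).
Proof.
case: c => x y; apply/flatten_mapP/idP => [[b]|/= lt_x].
  by rewrite mem_iota => _ /mapP[a]; rewrite mem_iota /= => lt_a [-> ->].
exists y; last by apply/mapP; exists x; rewrite // mem_iota.
rewrite mem_iota /= add0n ltnNge; apply: contraL lt_x => le_y.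
by rewrite nth_default.
Qed.

Lemma uniq_diagram la : uniq (diagram la).
Proof.
apply: (@allpairs_uniq_dep nat (fun=> nat) (nat * nat)%type (fun b a => (a, b))
  (iota 0 (size la)) (fun b => iota 0 (nth 0 la b))); rewrite ?iota_uniq //.
  by move=> b _; apply: iota_uniq.
by move=> [b a] [b' a'] _ _ /= [-> ->].
Qed.

Lemma size_diagram la : size (diagram la) = sumn la.
Proof.
rewrite size_flatten /shape -map_comp -[in RHS](mkseq_nth 0 la).
by congr sumn; apply: eq_map => b /=; rewrite size_map size_iota.
Qed.

Definition precedes (cs : seq (nat * nat)) (p q : nat) : bool :=
  let x := nth (0, 0) cs p in let y := nth (0, 0) cs q in
  ((x.2 == y.2) && (x.1 < y.1)) || ((x.1 == y.1) && (x.2 < y.2)).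

Definition order_pairs (cs : seq (nat * nat)) : seq (nat * nat) :=
  [seq pq <- [seq (p, q) | p <- iota 0 (size cs), q <- iota 0 (size cs)] |
    precedes cs pq.1 pq.2].

(** Rows from top to bottom, each from left to right. Labels then grow along rows, where
    semistandard tableaux increase weakly, and drop up columns, where they increase strictly. *)
Definition row_reading : rel (nat * nat) :=
  fun x y => (y.2 < x.2) || ((x.2 == y.2) && (x.1 <= y.1)).

Definition row_labels (cs : seq (nat * nat)) : seq nat :=
  [seq index c (sort row_reading cs) | c <- cs].

(** A word [u] respecting the pairs is a standard Young tableau, given by the successive cells of
    its entries. Its labels descend where the next entry sits in a higher row, so the codes are the
    usual descent sets. *)
Definition schur_codes (la : seq nat) : seq (seq bool) :=
  let cs := diagram la in
  let cov := order_pairs cs in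
  let l := row_labels cs in
  [seq dcode (map (nth 0 l) u) | u <- permutations (iota 0 (size cs)) &
    all (fun pq => index pq.1 u < index pq.2 u) cov].

Lemma row_reading_trans : transitive row_reading.
Proof.
move=> y x z; rewrite /row_reading => /orP[h|/andP[/eqP-> h]] /orP[h'|/andP[/eqP<- h']].
- by rewrite (ltn_trans h' h).
- by rewrite h.
- by rewrite h'.
- by rewrite eqxx (leq_trans h h') orbT.
Qed.

Lemma row_reading_total : total row_reading.
Proof.
move=> x y; rewrite /row_reading; case: (ltngtP x.2 y.2) => //= _.
exact: leq_total.
Qed.

Section PermutationLists.
Variable m : nat.

Definition perm_word (s : 'S_m) : seq nat := [seq val (s i) | i <- enum 'I_m].

Lemma perm_word_inj : injective perm_word.
Proof.
move=> s s' e; apply/permP => i; apply: val_inj.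
have nE (r : 'S_m) : nth 0 (perm_word r) i = r i.
  by rewrite (nth_map i) ?size_enum_ord ?ltn_ord // nth_ord_enum.
by rewrite /= -!nE e.
Qed.

Lemma index_perm_word (s : 'S_m) (p : 'I_m) : index (val p) (perm_word s) = s^-1%g p.
Proof.
have inj : injective (fun i => val (s i)) by move=> i j /val_inj /perm_inj.
by rewrite -[in val p](permKV s p) (index_map inj) index_enum_ord.
Qed.

(** Turns sums over ['S_m] into a computable enumeration. *)
Lemma perm_words : perm_eq (map perm_word (enum 'S_m)) (permutations (iota 0 m)).
Proof.
have un : uniq (map perm_word (enum 'S_m)).
  by rewrite (map_inj_uniq perm_word_inj) enum_uniq.
have sub : {subset map perm_word (enum 'S_m) <= permutations (iota 0 m)}.
  move=> u /mapP[s _ ->]; rewrite mem_permutations -val_enum_ord.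
  rewrite /perm_word map_comp perm_map //.
  apply: uniq_perm; rewrite ?(map_inj_uniq perm_inj) ?enum_uniq // => i.
  rewrite mem_enum; apply/mapP; exists (s^-1%g i); rewrite ?mem_enum //.
  by rewrite permKV.
apply: uniq_perm => //; first exact: permutations_uniq.
have [|_ e] := uniq_min_size un sub; last by move=> u; rewrite e.
by rewrite size_permutations ?iota_uniq // size_iota size_map -cardE card_Sn.
Qed.

End PermutationLists.

Section SchurExpansion.
Variable la : seq nat.
Let cs := diagram la.
Let m := size cs.

Let lab (i : 'I_m) : nat := nth 0 (row_labels cs) i.

Let labE i : lab i = index (nth (0, 0) cs i) (sort row_reading cs).
Proof. by rewrite /lab (nth_map (0, 0)) ?ltn_ord. Qed.

Let in_sort (i : 'I_m) : nth (0, 0) cs i \in sort row_reading cs.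
Proof. by rewrite mem_sort mem_nth ?ltn_ord. Qed.

Let lab_inj : injective lab.
Proof.
move=> p q; rewrite !labE => e; apply: val_inj; apply/eqP.
rewrite -(nth_uniq (0, 0) (ltn_ord p) (ltn_ord q) (uniq_diagram la)); apply/eqP.
by rewrite -[LHS](nth_index (0, 0) (in_sort p)) e nth_index.
Qed.

Let lab_lt (p q : 'I_m) : ~~ row_reading (nth (0, 0) cs q) (nth (0, 0) cs p) -> lab p < lab q.
Proof.
rewrite !labE ltnNge; apply: contra => le_qp.
apply: (sorted_leq_index row_reading_trans _ _ _ _ (in_sort q) (in_sort p) le_qp).
  by move=> x; rewrite /row_reading leqnn eqxx orbT.
exact/sort_sorted/row_reading_total.
Qed.

Let R : rel 'I_m := fun p q => precedes cs p q.

(** Gessel's expansion of a Schur function: semistandard fillings are the P-partitions of the cell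
    order with the row-reading labels. *)
Lemma schur_coef_expansion N (a : 'I_N -> nat) :
  schur_coef la N a = \sum_(c <- schur_codes la) Qcoef (size (diagram la)) (des_of c) N a.
Proof.
have R_irr : irreflexive R by move=> p; rewrite /R /precedes !ltnn !andbF.
rewrite /schur_coef -/cs.
transitivity #|[set f : {ffun 'I_m -> 'I_N} | respects R lab f && has_content a f]|.
  apply: eq_card => f; rewrite !inE; congr (_ && _).
  apply: eq_forallb => p; apply: eq_forallb => q; rewrite /R /precedes.
  have := @lab_lt p q; have := @lab_lt q p; rewrite /row_reading.
  case: (ltngtP (nth (0, 0) cs p).2 (nth (0, 0) cs q).2) => //=.
  - by move=> _; case: eqP => //= _ /(_ isT) ->.
  - by move=> _; rewrite andbF.
  move=> _; rewrite andbF orbF andbT -ltnNge.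
  case: (ltnP (nth (0, 0) cs p).1) => //= _ _ /(_ isT) lt_pq.
  by rewrite (ltnNge (lab q)) (ltnW lt_pq).
rewrite (ppartition a lab_inj R_irr) /schur_codes -/cs -/m big_map big_filter.
rewrite -(perm_big _ (perm_words m)) big_map big_enum_cond /=.
apply: eq_big => [s|s _]; last first.
  by rewrite /perm_word -map_comp.
apply/idP/allP => [/forallP lin [p q]|H].
  rewrite mem_filter => /andP[/= pq /allpairsP[[p' q'] /= [p'm q'm [e e']]]].
  move: p'm q'm pq; rewrite -{}e -{}e' !mem_iota /= => pm qm pq.
  move/forallP/(_ (Ordinal qm))/implyP: (lin (Ordinal pm)) => /(_ pq).
  by rewrite -(index_perm_word s (Ordinal pm)) -(index_perm_word s (Ordinal qm)).
apply/forallP => p; apply/forallP => q; apply/implyP => pq.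
rewrite -!index_perm_word.
apply: (H (val p, val q)); rewrite mem_filter /= {1}/R in pq *; rewrite pq /=.
by apply/allpairsP; exists (val p, val q); rewrite !mem_iota !ltn_ord.
Qed.

End SchurExpansion.

(** * Local moves and a search for their classes *)

Definition btw (x y z : nat) : bool := (x < y < z) || (z < y < x).

(** Arguments are the reading positions of [i-1], [i], [i+1], results their new positions. If [y] is
    extreme, the farther of [i-1] and [i+1] is the other extreme: the far move exchanges the two
    extremes, the near move rotates all three. *)
Definition move (far : rel nat) (x y z : nat) : nat * nat * nat :=
  if btw x y z then (x, y, z)
  else if btw y x z then (if far y z then (x, z, y) else (y, z, x))
  else (if far x y then (y, x, z) else (z, x, y)).

Fixpoint step (far : rel nat) (i : nat) (u : seq nat) : seq nat :=
  match i, u with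
  | 0, x :: y :: z :: r => let: (a, b, c) := move far x y z in [:: a, b, c & r]
  | i'.+1, x :: r => x :: step far i' r
  | _, _ => u
  end.

(** The extremes stay the same two positions, so [far] answers alike both times. A far move leaves
    the median in place; a near move carries it between the first and third places by mutually
    inverse rotations. *)
Lemma move_involutive far x y z : symmetric far -> uniq [:: x; y; z] ->
  let: (a, b, c) := move far x y z in move far a b c = (x, y, z).
Proof.
move=> far_sym un.
have nxy : x != y by move: un; rewrite /= !inE; lia.
have nxz : x != z by move: un; rewrite /= !inE; lia.
have nyz : y != z by move: un; rewrite /= !inE; lia.
have btwC p q r : btw p q r = btw r q p by rewrite /btw; lia.
have tri p q r : btw p q r -> btw q p r = false by rewrite /btw; lia.
have tri' : ~~ btw x y z -> ~~ btw y x z -> btw x z y by rewrite /btw; lia.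
rewrite /move; case xyz: (btw x y z); first by rewrite xyz.
case yxz: (btw y x z) => /=.
  have xzy : btw x z y = false by apply: tri; rewrite btwC.
  case f: (far y z); first by rewrite xzy (btwC z) yxz (far_sym z) f.
  by rewrite (btwC y) xzy (btwC z) xyz f.
have xzy : btw x z y by apply: tri'; rewrite ?xyz ?yxz.
case f: (far x y); first by rewrite yxz xyz (far_sym y) f.
by rewrite (btwC z) yxz xzy f.
Qed.

Lemma step_involutive far i u : symmetric far -> uniq u ->
  step far i (step far i u) = u.
Proof.
move=> far_sym; elim: i u => [|i IH] [|x u] //=; last first.
  by move=> /andP[_ /IH ->].
case: u => [|y [|z r]] //= un.
have := @move_involutive far x y z far_sym.
case: (move far x y z) => [[a b] c] -> //.
by move: un; rewrite /= !inE; lia.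
Qed.

Lemma move_perm far x y z r :
  let: (a, b, c) := move far x y z in perm_eq [:: a, b, c & r] [:: x, y, z & r].
Proof.
by rewrite /move; do ![case: ifP => _] => //; apply/seq.permP => p /=; lia.
Qed.

Lemma step_perm far i u : perm_eq (step far i u) u.
Proof.
elim: i u => [|i IH] [|x u] //=; last by rewrite perm_cons.
case: u => [|y [|z r]] //; have := move_perm far x y z r.
by case: move => [[a b] c].
Qed.

Lemma size_step far i u : size (step far i u) = size u.
Proof. exact/perm_size/step_perm. Qed.

(** [far] is consulted only on the two extremes of a triple, a pair with a term strictly between. *)
Lemma eq_step far far' i u : uniq u ->
  {in u & &, forall x y z, btw y x z -> far y z = far' y z} ->
  step far i u = step far' i u.
Proof.
elim: i u => [|i IH] [|x u] //= un H; last first.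
  rewrite IH //; first by case/andP: un.
  by move=> a b c au bu cu; apply: H; rewrite inE ?au ?bu ?cu orbT.
case: u un H => [|y [|z r]] //= un H; rewrite /move.
case xyz: (btw x y z) => //; case yxz: (btw y x z).
  by rewrite (H x y z) ?inE ?eqxx ?orbT.
rewrite (H z x y) ?inE ?eqxx ?orbT //.
by move: un xyz yxz; rewrite /btw /= !inE; lia.
Qed.

(** * Certified search of the classes of words *)

Inductive trie := Trie of bool & seq trie.

Definition tempty := Trie false [::].

Fixpoint tmem (t : trie) (s : seq nat) : bool :=
  let: Trie f c := t in
  if s is x :: s' then tmem (nth tempty c x) s' else f.

Fixpoint tins (t : trie) (s : seq nat) : trie :=
  let: Trie f c := t in
  if s is x :: s' then Trie f (set_nth tempty c x (tins (nth tempty c x) s'))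
  else Trie true c.

Lemma tmem_empty s : tmem tempty s = false.
Proof. by elim: s => //= x s; rewrite nth_nil. Qed.

Lemma tmem_ins t s s' : tmem (tins t s) s' = (s' == s) || tmem t s'.
Proof.
elim: s t s' => [|x s IH] [f c] [|y s'] //=.
rewrite nth_set_nth /= eqseq_cons; case: eqP => [->|] //=.
Qed.

Lemma tmem_foldl t X v : tmem (foldl tins t X) v = (v \in X) || tmem t v.
Proof.
by elim: X t => //= w X IH t; rewrite IH tmem_ins inE orbCA orbA.
Qed.

Section Search.
Variable next : seq nat -> seq (seq nat).

Fixpoint dfs (fuel : nat) (q : seq (seq nat)) (t : trie) (acc : seq (seq nat)) :
    trie * seq (seq nat) :=
  match fuel, q with
  | fuel'.+1, u :: q' =>
      if tmem t u then dfs fuel' q' t acc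
      else dfs fuel' (next u ++ q') (tins t u) (u :: acc)
  | _, _ => (t, acc)
  end.

(** Closure under [next] is not claimed, so any amount of fuel is sound; [check_classes] tests
    closure afterwards. The last clause is induction over reachable words. *)
Lemma dfsP fuel q t acc : (forall v, tmem t v = (v \in acc)) -> uniq acc ->
  let: (t', X) := dfs fuel q t acc in
  [/\ forall v, tmem t' v = (v \in X), uniq X, {subset acc <= X}
    & forall Q : seq nat -> Prop, (forall v, v \in acc -> Q v) ->
        (forall v, v \in q -> Q v) ->
        (forall v w, Q v -> w \in next v -> Q w) -> forall v, v \in X -> Q v].
Proof.
elim: fuel q t acc => [|fuel IH] [|u q] t acc tE un /=; try by split.
case tu: (tmem t u).
  have := IH q t acc tE un; case: dfs => t' X [? ? ? H]; split=> // Q Qa Qq Qn.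
  by apply: H => // v vq; apply: Qq; rewrite inE vq orbT.
have tE' v : tmem (tins t u) v = (v \in u :: acc) by rewrite tmem_ins inE tE.
have un' : uniq (u :: acc) by rewrite /= -tE tu.
have := IH (next u ++ q) _ _ tE' un'; case: dfs => t' X [? ? sub H]; split=> //.
  by move=> v va; apply: sub; rewrite inE va orbT.
move=> Q Qa Qq Qn; have Qu : Q u by apply: Qq; rewrite mem_head.
apply: H => // v; first by rewrite inE => /predU1P[->|/Qa].
rewrite mem_cat => /orP[|vq]; first exact: Qn.
by apply: Qq; rewrite inE vq orbT.
Qed.

End Search.

Arguments dfs : simpl never.

Fixpoint subtract (C D : seq (seq bool)) : option (seq (seq bool)) :=
  if D is d :: D' then if d \in C then subtract (rem d C) D' else None else Some C.

Lemma subtractP C D C' : subtract C D = Some C' -> perm_eq C (D ++ C').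
Proof.
elim: D C => [|d D IH] C /=; first by move=> [->].
case: ifP => // dC /IH H; apply: perm_trans (perm_to_rem dC) _.
by rewrite /= perm_cons.
Qed.

(* Descent code of the superstandard tableau: it has multiplicity one in
   [schur_codes la] and occurs in no [schur_codes nu] with [nu] after [la] in
   the lists [partitions m] below, which makes greedy decomposition work. *)
Definition row_code (la : seq nat) : seq bool :=
  behead (flatten [seq true :: nseq a.-1 false | a <- la]).

Fixpoint decompose (fuel : nat)
    (tb : seq (seq nat * (seq bool * seq (seq bool)))) (C : seq (seq bool)) :
    option (seq (seq nat)) :=
  match fuel, tb with
  | f.+1, e :: tb' =>
     if e.2.1 \in C then
       if subtract C e.2.2 is Some C' then
         if decompose f tb C' is Some L then Some (e.1 :: L) else None
       else None
     else decompose f tb' C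
  | _, _ => if nilp C then Some [::] else None
  end.

Definition schur_table (P : seq (seq nat)) :=
  [seq (la, (row_code la, schur_codes la)) | la <- P].

(** The successive subtractions certify the result; a bad greedy choice or too little fuel can only
    yield [None]. *)
Lemma decomposeP fuel P C L : decompose fuel (schur_table P) C = Some L ->
  {subset L <= P} /\ perm_eq C (flatten (map schur_codes L)).
Proof.
elim: fuel P C L => [|fuel IH] [|la P] C L /=; try by case: ifP => // /nilP -> [<-].
case: ifP => _; last first.
  by move=> /IH[sub pC]; split=> // mu /sub; rewrite inE orbC => ->.
case e: subtract => [C'|] //; case e': decompose => [L'|] // [<-].
have [sub pC] := IH (la :: P) _ _ e'; split.
  by move=> mu; rewrite inE => /predU1P[->|/sub //]; rewrite mem_head.
by apply: perm_trans (subtractP e) _; rewrite perm_cat2l.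
Qed.

Section ClassSearch.
Variables (fuel : nat) (next : seq nat -> seq (seq nat)) (P : seq (seq nat)).
Variable bad : pred (seq nat).

(** [bad] marks words that may not lie in a class with several Schur functions; one marked word in a
    class suffices to demand a single one. [t] holds the words of the classes already treated. *)
Fixpoint check_classes tb (ps : seq (seq nat)) (t : trie) : bool :=
  if ps is u :: ps' then
    if tmem t u then check_classes tb ps' t
    else let: (lt, X) := dfs next fuel.+1 [:: u] tempty [::] in
      [&& all (fun v => all (tmem lt) (next v)) X,
          (if decompose fuel tb (map dcode X) is Some L
           then if size L == 1 then true else ~~ has bad X else false)
          & check_classes tb ps' (foldl tins t X)]
  else true.

Definition good_class (X : seq (seq nat)) : Prop :=
  [/\ uniq X, forall v w, v \in X -> w \in next v -> w \in X,
      exists2 u0, u0 \in X & forall Q : seq nat -> Prop, Q u0 ->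
        (forall v w, Q v -> w \in next v -> Q w) -> forall v, v \in X -> Q v
    & exists L, [/\ {subset L <= P}, perm_eq (map dcode X) (flatten (map schur_codes L))
                 & (size L == 1) || ~~ has bad X]].

Lemma check_classesP ps t :
  (forall v, tmem t v -> exists2 X, v \in X & good_class X) ->
  check_classes (schur_table P) ps t ->
  forall u, u \in ps -> exists2 X, u \in X & good_class X.
Proof.
elim: ps t => [|u ps IH] t tgood //=.
have use t' : (forall v, tmem t' v -> exists2 X, v \in X & good_class X) ->
    (exists2 X, u \in X & good_class X) ->
    check_classes (schur_table P) ps t' ->
    forall v, v \in u :: ps -> exists2 X, v \in X & good_class X.
  by move=> tg ug chk v; rewrite inE => /predU1P[->|/(IH _ tg chk)].
case: ifP => [/tgood ug|_]; first exact: use.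
have := dfsP next fuel.+1 [:: u] (t := tempty) (acc := [::]) tmem_empty isT.
have uX : u \in (dfs next fuel.+1 [:: u] tempty [::]).2.
  have tE v : tmem (tins tempty u) v = (v \in [:: u]).
    by rewrite tmem_ins tmem_empty orbF inE.
  have := dfsP next fuel (next u ++ [::]) tE isT.
  have -> : dfs next fuel.+1 [:: u] tempty [::] = dfs next fuel (next u ++ [::]) (tins tempty u) [:: u].
    by transitivity (if tmem tempty u then dfs next fuel [::] tempty [::]
      else dfs next fuel (next u ++ [::]) (tins tempty u) [:: u]); last by rewrite tmem_empty.
  by case: dfs => t' X [_ _ sub _]; apply: sub; rewrite mem_head.
move: uX; case: (dfs next fuel.+1 _ _ _) => lt X /= uX [ltE un _ reach] /and3P[closed dec chk].
have gX : good_class X.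
  split=> //.
  - by move=> v w vX wv; rewrite -ltE; move/allP/(_ _ vX)/allP/(_ _ wv): closed.
  - exists u => // Q Qu Qn; apply: reach => // v.
    by rewrite inE => /eqP->.
  - move: dec; case e: decompose => [L|] // single; exists L.
    by have [sub pX] := decomposeP e; split=> //; move: single; case: eqP.
apply: use chk => //; last by exists X.
move=> v; rewrite tmem_foldl => /orP[vX|/tgood //]; by exists X.
Qed.

End ClassSearch.

(** * The finite check *)

Fixpoint partitions_below (fuel m b : nat) : seq (seq nat) :=
  if fuel is f.+1 then
    if m == 0 then [:: [::]]
    else flatten [seq [seq a :: r | r <- partitions_below f (m - a) a]
                 | a <- rev (iota 1 (minn m b))]
  else [:: [::]].

Definition partitions (m : nat) : seq (seq nat) := partitions_below m m m.

(* Only pairs of positions at distance at least 2 are ever compared by [step],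
   so a nondecreasing [C] matters only through, for each [p], the last
   position within [k] of [p], rounded up to [p + 1]. *)
Definition bound (k : nat) (C : seq nat) (p : nat) : nat :=
  maxn p.+1 (count (fun x => x <= nth 0 C p + k) C).-1.

Definition bounds_of (k : nat) (C : seq nat) : seq nat :=
  [seq bound k C p | p <- iota 0 (size C - 2)].

Definition far_bound (b : seq nat) : rel nat :=
  fun x y => if x < y then nth 0 b x < y else nth 0 b y < x.

Definition far_content (k : nat) (C : seq nat) : rel nat :=
  fun x y => (nth 0 C x + k < nth 0 C y) || (nth 0 C y + k < nth 0 C x).

Fixpoint bound_seqs (len p lo M : nat) : seq (seq nat) :=
  if len is len'.+1 then
    let mx := maxn lo p.+1 in
    flatten [seq [seq x :: r | r <- bound_seqs len' p.+1 x M] | x <- iota mx (M.+1 - mx)]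
  else [:: [::]].

(** For [b = bounds_of k C]: positions [p] and [p+3] are always more than [k] apart, so no four
    cells are mutually close. *)
Fixpoint short (p : nat) (b : seq nat) : bool :=
  if b is x :: b' then (x <= p.+2) && short p.+1 b' else true.

Definition steps (far : rel nat) (m : nat) (u : seq nat) : seq (seq nat) :=
  [seq step far i u | i <- iota 0 (m - 2)].

(** [R p x q] stands for the entry of [x] lying between those of [p] and [q]. With [R] constantly
    true, a condition on contents alone remains, which discards lists [C] before any word is
    examined. *)
Definition admissible (k : nat) (C : seq nat) (R : nat -> nat -> nat -> bool) : bool :=
  let I := iota 0 (size C) in
  all (fun p => all (fun q => if (p < q) && (nth 0 C p == nth 0 C q) then
      has (fun x => if nth 0 C x + k == nth 0 C p then R p x q else false) I &&
      has (fun y => if nth 0 C y == nth 0 C p + k then R p y q else false) I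
    else true) I) I.

Lemma admissibleP k C (R : nat -> nat -> nat -> bool) : reflect
  (forall p q, p < q -> q < size C -> nth 0 C p = nth 0 C q ->
    (exists x, [/\ x < size C, nth 0 C x + k = nth 0 C p & R p x q]) /\
    (exists y, [/\ y < size C, nth 0 C y = nth 0 C p + k & R p y q]))
  (admissible k C R).
Proof.
have hasI (Q : pred nat) : reflect (exists2 x, x < size C & Q x) (has Q (iota 0 (size C))).
  apply: (iffP hasP) => [] [x xI Qx]; exists x => //; by rewrite mem_iota in xI *.
apply: (iffP allP) => [adm p q pq qm e|adm p]; last first.
  rewrite mem_iota => pm; apply/allP => q; rewrite mem_iota => qm.
  case: ifP => // /andP[pq /eqP e]; have [[x [xm ex Rx]] [y [ym ey Ry]]] := adm p q pq qm e.
  by apply/andP; split; apply/hasI; [exists x | exists y] => //; rewrite ?ex ?ey eqxx.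
have pI : p \in iota 0 (size C) by rewrite mem_iota (ltn_trans pq).
have qI : q \in iota 0 (size C) by rewrite mem_iota.
move/(_ p pI)/allP/(_ q qI): adm; rewrite pq e eqxx /=.
move=> /andP[/hasI[x xm] + /hasI[y ym]].
by do 2![case: eqP => // ?] => Ry Rx; split; [exists x | exists y].
Qed.

Definition word_between (u : seq nat) (p x q : nat) : bool :=
  index p u < index x u < index q u.

(** [x] is the previous content and [a] its clipped value. For [k = 2] it only matters whether
    contents differ by 0, by 2 or by more than 2, so gaps are cut at 3. *)
Fixpoint clip_from (x a : nat) (C : seq nat) : seq nat :=
  if C is y :: C' then
    let a' := a + minn 3 (y - x) in a' :: clip_from y a' C'
  else [::].

Definition clip (C : seq nat) : seq nat := 0 :: clip_from (head 0 C) 0 (behead C).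

Fixpoint clipped_seqs (len a : nat) : seq (seq nat) :=
  if len is len'.+1 then
    flatten [seq [seq (a + d) :: r | r <- clipped_seqs len' (a + d)] | d <- iota 0 4]
  else [:: [::]].

Definition check_all (m : nat) : bool :=
  let P := partitions m in
  let tb := schur_table P in
  let ps := permutations (iota 0 m) in
  all (fun la => is_partition la && (sumn la == m)) P &&
  all (fun b => let s := short 0 b in
         check_classes 400 (steps (far_bound b) m) (fun=> s) tb ps tempty)
      (bound_seqs (m - 2) 0 0 m.-1).

(** Lists with short bounds are settled by [check_all]; lists failing [admissible] for the trivial
    relation carry no admissible word. *)
Definition check_domino (m : nat) : bool :=
  let tb := schur_table (partitions m) in
  let ps := permutations (iota 0 m) in
  all (fun C => let b := bounds_of 2 C in
         if short 0 b then true
         else if admissible 2 C (fun _ _ _ => true) then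
           check_classes 400 (steps (far_bound b) m)
             (fun u => admissible 2 C (word_between u)) tb ps tempty
         else true)
      [seq 0 :: C | C <- clipped_seqs m.-1 0].

(** [iota 3 4] is 3, ..., 6: the window sizes [i - h + 3] with [i - h <= 3]. *)
Lemma check_all_holds : all check_all (iota 3 4).
Proof. by vm_compute. Qed.

Lemma check_domino_holds : all check_domino (iota 3 4).
Proof. by vm_compute. Qed.

Lemma mem_bound_seqs len p lo M b : size b = len ->
  (forall j, j < len -> p + j < nth 0 b j <= M) -> path leq lo b ->
  b \in bound_seqs len p lo M.
Proof.
elim: len p lo b => [|len IH] p lo [|x b] //= [sz] H /andP[lox pb].
have x_lt : p < x <= M by have := H 0 isT; rewrite addn0.
apply/flatten_mapP; exists x; first by rewrite mem_iota; lia.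
rewrite map_f // IH // => j lt_j.
by have := H j.+1 lt_j; rewrite addnS.
Qed.

(** The elements at most [v] form an initial segment, whose length is the count. *)
Lemma count_sorted C v r : sorted leq C -> r < size C ->
  (r < count (fun x => x <= v) C) = (nth 0 C r <= v).
Proof.
elim: C r => [|x C IH] [|r] //= srt lt_r.
  rewrite addn_gt0 lt0b; case le_xv: (x <= v) => //=.
  rewrite -has_count; apply/hasPn => y yC; move: srt.
  rewrite path_sortedE; last exact: leq_trans.
  by move=> /andP[/allP/(_ _ yC) xy _]; rewrite -ltnNge (leq_trans _ xy) // ltnNge le_xv.
have srtC := path_sorted srt.
case le_xv: (x <= v); first by rewrite add1n ltnS IH.
rewrite add0n -IH //.
have -> : count (fun x => x <= v) C = 0; last by rewrite !ltn0.
apply/eqP; rewrite -leqn0 leqNgt -has_count; apply/hasPn => y yC; move: srt.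
rewrite path_sortedE; last exact: leq_trans.
by move=> /andP[/allP/(_ _ yC) xy _]; rewrite -ltnNge (leq_trans _ xy) // ltnNge le_xv.
Qed.

Lemma nth_bounds_of k C p : p < size C - 2 -> nth 0 (bounds_of k C) p = bound k C p.
Proof. by move=> lt_p; rewrite (nth_map 0) ?size_iota // nth_iota. Qed.

Lemma nth_le_sorted C p q : sorted leq C -> p <= q -> q < size C -> nth 0 C p <= nth 0 C q.
Proof.
move=> srt le_pq lt_q; apply: (sorted_leq_nth leq_trans leqnn) => //.
by rewrite inE (leq_ltn_trans le_pq).
Qed.

(** The rounding up to [x+1] inside [bound] cannot reach [y], which is at least [x+2]. *)
Lemma far_boundE k C x y : sorted leq C -> x.+1 < y -> y < size C ->
  (nth 0 (bounds_of k C) x < y) = (nth 0 C x + k < nth 0 C y).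
Proof.
move=> srt xy ym; rewrite nth_bounds_of; last by lia.
have := count_sorted (nth 0 C x + k) srt ym; rewrite /bound.
by move: (count _ C) => c; lia.
Qed.

Lemma far_bound_content k C x y z : sorted leq C ->
  x < size C -> y < size C -> z < size C -> btw y x z ->
  far_content k C y z = far_bound (bounds_of k C) y z.
Proof.
move=> srt xm ym zm yxz; rewrite /far_content /far_bound.
case: (ltnP y z) => yz.
  rewrite far_boundE //; last by move: yxz; rewrite /btw; lia.
  by have := nth_le_sorted srt (ltnW yz) zm; lia.
rewrite far_boundE //; last by move: yxz; rewrite /btw; lia.
by have := nth_le_sorted srt yz ym; lia.
Qed.

Lemma bounds_of_mem k C : 2 < size C -> sorted leq C ->
  bounds_of k C \in bound_seqs (size C - 2) 0 0 (size C).-1.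
Proof.
move=> szC srt; apply: mem_bound_seqs; first by rewrite size_map size_iota.
  move=> j lt_j; rewrite nth_bounds_of // /bound.
  by have := count_size (fun x => x <= nth 0 C j + k) C; lia.
rewrite path_min_sorted; last by apply/allP.
apply/(sortedP 0) => i; rewrite size_map size_iota => lt_i.
rewrite !nth_bounds_of ?(ltnW lt_i) // /bound.
have le_n : nth 0 C i <= nth 0 C i.+1 by apply: nth_le_sorted => //; lia.
have : count (fun x => x <= nth 0 C i + k) C <= count (fun x => x <= nth 0 C i.+1 + k) C.
  by apply: sub_count => x /=; lia.
by lia.
Qed.

(** * Clipped contents *)

Lemma clip_from_mem x a C : clip_from x a C \in clipped_seqs (size C) a.
Proof.
elim: C x a => //= y C IH x a; set d := minn 3 (y - x).
have : d < 4 by rewrite /d; lia.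
case: d => [|[|[|[|d]]]] //= _; rewrite !mem_cat map_f ?orbT //; exact: IH.
Qed.

(** A sum of gaps and the sum of the gaps cut at 3 agree once cut at 3 themselves, so the
    differences survive for all pairs and not only for neighbours. *)
Lemma clip_fromP x a C p q : path leq x C -> p <= q -> q <= size C ->
  nth 0 (a :: clip_from x a C) p <= nth 0 (a :: clip_from x a C) q /\
  minn 3 (nth 0 (a :: clip_from x a C) q - nth 0 (a :: clip_from x a C) p)
  = minn 3 (nth 0 (x :: C) q - nth 0 (x :: C) p).
Proof.
elim: C x a p q => [|y C IH] x a p q; first by case: p q => [|p] [|q] //= _ _ _; lia.
rewrite [path _ _ _]/= => /andP[xy pC] pq qC.
case: p q pq qC => [|p] [|q] // pq qC; [by lia| |exact: IH].
have [le0 e0] := IH y (a + minn 3 (y - x)) 0 q pC isT qC.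
have := IH y y 0 q pC isT qC.
have lexy : y <= nth 0 (y :: C) q.
  by apply: (@nth_le_sorted (y :: C) 0 q).
rewrite -[nth 0 (a :: _) q.+1]/(nth 0 (a + minn 3 (y - x) :: clip_from y (a + minn 3 (y - x)) C) q).
rewrite -[nth 0 (x :: _) q.+1]/(nth 0 (y :: C) q).
by move: le0 e0; rewrite ![nth 0 _ 0]/=; lia.
Qed.

Lemma size_clip C : 0 < size C -> size (clip C) = size C.
Proof.
case: C => // x C _ /=; congr _.+1.
by elim: C x (0 : nat) => //= y C IH x a; rewrite IH.
Qed.

Lemma clipP C p q : 0 < size C -> sorted leq C -> p < size C -> q < size C ->
  minn 3 (nth 0 (clip C) q - nth 0 (clip C) p) = minn 3 (nth 0 C q - nth 0 C p).
Proof.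
case: C => // x C _ srt pm qm; rewrite /clip [head _ _]/= [behead _]/=.
case: (leqP p q) => pq; first by have [] := clip_fromP 0 srt pq qm.
have [le1 _] := clip_fromP 0 srt (ltnW pq) pm.
by have := nth_le_sorted srt (ltnW pq) pm; lia.
Qed.

Lemma clip_sorted C : 0 < size C -> sorted leq C -> sorted leq (clip C).
Proof.
move=> sz srt; apply/(sortedP 0) => i; rewrite size_clip // => lt_i.
case: C sz srt lt_i => // x C _ srt lt_i.
by have [] := clip_fromP 0 srt (leqnSn i) lt_i.
Qed.

Lemma far_content_clip C x y : 0 < size C -> sorted leq C -> x < size C -> y < size C ->
  far_content 2 (clip C) x y = far_content 2 C x y.
Proof.
move=> sz srt xm ym; rewrite /far_content.
by have := clipP sz srt xm ym; have := clipP sz srt ym xm; lia.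
Qed.

Lemma admissible_clip C R : 0 < size C -> sorted leq C ->
  admissible 2 C R -> admissible 2 (clip C) R.
Proof.
move=> sz srt /admissibleP adm; apply/admissibleP => p q pq.
rewrite size_clip // => qm e; have pm := ltn_trans pq qm.
have [] := adm p q pq qm.
  by have := clipP sz srt pm qm; have := nth_le_sorted srt (ltnW pq) qm; lia.
move=> [x [xm ex Rx]] [y [ym ey Ry]].
split; [exists x | exists y]; split=> //.
  by have := clipP sz srt xm pm; have := clipP sz srt pm xm; lia.
by have := clipP sz srt pm ym; have := clipP sz srt ym pm; lia.
Qed.

Lemma admissible_sub k C (R R' : nat -> nat -> nat -> bool) :
  (forall p x q, R p x q -> R' p x q) -> admissible k C R -> admissible k C R'.
Proof.
move=> sub /admissibleP adm; apply/admissibleP => p q pq qm e.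
have [[x [xm ex /sub Rx]] [y [ym ey /sub Ry]]] := adm p q pq qm e.
by split; [exists x | exists y].
Qed.

(** * Classes of patterns and their Schur expansions *)

Definition step_class (far : rel nat) (m : nat) (u : seq nat) (X : seq (seq nat)) : Prop :=
  [/\ u \in X, uniq X, forall v i, i < m - 2 -> v \in X -> step far i v \in X
    & forall Q : seq nat -> Prop, Q u ->
        (forall v i, i < m - 2 -> Q v -> Q (step far i v)) -> forall v, v \in X -> Q v].

Definition schur_expansion (m : nat) (X : seq (seq nat)) (L : seq (seq nat)) : Prop :=
  all (fun la => is_partition la && (sumn la == m)) L /\
  perm_eq (map dcode X) (flatten (map schur_codes L)).

Lemma mem_steps far m u w :
  reflect (exists2 i, i < m - 2 & w = step far i u) (w \in steps far m u).
Proof.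
by apply: (iffP mapP) => [] [i im ->]; exists i => //; rewrite mem_iota in im *.
Qed.

(** The search may have started at another word [u0] of the class. Steps are involutions, so a path
    from [u0] to [u] can be run backwards and the induction can start at [u]. *)
Lemma good_class_step far m P bad X u : symmetric far ->
  u \in X -> perm_eq u (iota 0 m) -> good_class (steps far m) P bad X ->
  step_class far m u X.
Proof.
move=> far_sym uX pu [un closed [u0 u0X reach] _]; split=> //.
  by move=> v i im vX; apply: (closed v) => //; apply/mem_steps; exists i.
have invol v i : perm_eq v (iota 0 m) -> step far i (step far i v) = v.
  by move=> pv; apply: step_involutive => //; rewrite (perm_uniq pv) iota_uniq.
have pX v : v \in X -> perm_eq v (iota 0 m).
  have key : forall v, v \in X -> perm_eq v u0.
    apply: (reach (fun v => perm_eq v u0)) => // v' w pv' /mem_steps[i _ ->].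
    by apply: perm_trans (step_perm _ _ _) pv'.
  move=> /key pv; apply: perm_trans pv _; rewrite perm_sym in pu.
  by rewrite perm_sym; apply: perm_trans pu (key _ uX).
move=> Q Qu Qs.
have Qu0 : Q u0.
  suff : u \in X /\ (Q u -> Q u0) by case=> _; apply.
  (* The implication [Q v -> Q u0] is what propagates from [u0] towards [u]; membership in [X] makes
     each step invertible. *)
  apply: (reach (fun v => v \in X /\ (Q v -> Q u0))) => // v w [vX Qv] wv.
  have wX := closed _ _ vX wv; split=> // Qw; apply: Qv.
  have /mem_steps[i im ew] := wv.
  by rewrite -(invol v i (pX _ vX)) -ew; apply: Qs.
by apply: reach => // v w Qv /mem_steps[i im ->]; apply: Qs.
Qed.

Lemma far_bound_sym b : symmetric (far_bound b).
Proof. by move=> x y; rewrite /far_bound; case: (ltngtP x y) => // ->. Qed.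

Lemma eq_step_class far far' m u X : perm_eq u (iota 0 m) ->
  (forall x y z, x < m -> y < m -> z < m -> btw y x z -> far y z = far' y z) ->
  step_class far m u X -> step_class far' m u X.
Proof.
move=> pu eqf [uX un closed reach].
have stepE v i : perm_eq v (iota 0 m) -> step far i v = step far' i v.
  move=> pv; apply: eq_step; first by rewrite (perm_uniq pv) iota_uniq.
  move=> x y z; rewrite !(perm_mem pv) !mem_iota => xm ym zm; exact: eqf.
have pX v : v \in X -> perm_eq v (iota 0 m).
  apply: (reach (fun v => perm_eq v (iota 0 m))) => // w i _ pw.
  exact: perm_trans (step_perm _ _ _) pw.
split=> // [v i im vX|Q Qu Qs v vX]; first by rewrite -stepE ?pX //; apply: closed.
suff [] : perm_eq v (iota 0 m) /\ Q v by [].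
apply: (reach (fun v => perm_eq v (iota 0 m) /\ Q v)) => // w i im [pw Qw]; split.
  exact: perm_trans (step_perm _ _ _) pw.
by rewrite stepE //; apply: Qs.
Qed.

Section Patterns.
Variables (m : nat) (C u : seq nat).
Hypothesis m_range : 3 <= m <= 6.
Hypothesis sizeC : size C = m.
Hypothesis sortedC : sorted leq C.
Hypothesis perm_u : perm_eq u (iota 0 m).

Let u_perms : u \in permutations (iota 0 m).
Proof. by rewrite mem_permutations. Qed.

Let m_iota : m \in iota 3 4.
Proof. by rewrite mem_iota; lia. Qed.

Lemma sub_partitions L : {subset L <= partitions m} ->
  all (fun la => is_partition la && (sumn la == m)) L.
Proof.
move=> sub; have /allP/(_ m m_iota)/andP[/allP good _] := check_all_holds.
by apply/allP => la /sub; apply: good.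
Qed.

Lemma check_classes_expansion b bad :
  check_classes 400 (steps (far_bound b) m) bad (schur_table (partitions m))
     (permutations (iota 0 m)) tempty ->
  exists X, step_class (far_bound b) m u X /\
    exists2 L, schur_expansion m X L & bad u -> size L = 1.
Proof.
move=> chk.
have [|X uX gX] := check_classesP _ chk u_perms; first by move=> v; rewrite tmem_empty.
exists X; split; first exact: good_class_step (@far_bound_sym b) uX perm_u gX.
have [_ _ _ [L [sub pX single]]] := gX; exists L.
  by split=> //; apply: sub_partitions.
move=> bu; case/orP: single => [/eqP //|/negP[]].
by apply/hasP; exists u.
Qed.

Lemma pattern_expansion k : exists X, step_class (far_content k C) m u X /\
  exists2 L, schur_expansion m X L & short 0 (bounds_of k C) -> size L = 1.
Proof.
have sz2 : 2 < size C by rewrite sizeC; lia.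
have /allP/(_ m m_iota)/andP[_ /allP chk] := check_all_holds.
have := bounds_of_mem k sz2 sortedC; rewrite sizeC => /chk /check_classes_expansion.
move=> [X [clX expX]]; exists X; split=> //.
apply: eq_step_class clX => // x y z xm ym zm yxz.
by apply/esym; apply: far_bound_content yxz; rewrite ?sizeC.
Qed.

Lemma domino_pattern_expansion : admissible 2 C (word_between u) ->
  exists X, step_class (far_content 2 C) m u X /\
  exists2 L, schur_expansion m X L & size L = 1.
Proof.
move=> adm; have sz0 : 0 < size C by rewrite sizeC; lia.
have srt' := clip_sorted sz0 sortedC.
have szC' : size (clip C) = m by rewrite size_clip.
have farE x y : x < m -> y < m -> far_content 2 (clip C) x y = far_content 2 C x y.
  by move=> xm ym; apply: far_content_clip => //; rewrite sizeC.
have /allP/(_ m m_iota)/allP/(_ (clip C)) := check_domino_holds.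
have -> : clip C \in [seq 0 :: C0 | C0 <- clipped_seqs m.-1 0].
  by apply: map_f; rewrite -sizeC -size_behead clip_from_mem.
move=> /(_ isT) chk; cbv zeta in chk.
have [X [clX [L expX single]]] : exists X,
    step_class (far_bound (bounds_of 2 (clip C))) m u X /\
    exists2 L, schur_expansion m X L & size L = 1.
  have sz2 : 2 < size (clip C) by rewrite szC'; lia.
  have adm' := admissible_clip sz0 sortedC adm.
  move: chk; case: ifP => sh chk.
    have /allP/(_ m m_iota)/andP[_ /allP chk'] := check_all_holds.
    have := bounds_of_mem 2 sz2 srt'; rewrite szC' => /chk' /check_classes_expansion.
    by move=> [X [clX [L expX]]]; rewrite sh => /(_ isT) single; exists X; split=> //; exists L.
  move: chk; rewrite (admissible_sub _ adm') // => /check_classes_expansion.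
  by move=> [X [clX [L expX /(_ adm') single]]]; exists X; split=> //; exists L.
exists X; split; last by exists L.
apply: eq_step_class clX => // x y z xm ym zm yxz.
by rewrite -farE //; apply/esym; apply: far_bound_content yxz; rewrite ?szC'.
Qed.

End Patterns.

(* Doubling all contents turns the case [k = 1] into the case [k = 2]. *)
Lemma small_k_pattern_expansion m C u k : 3 <= m <= 6 -> size C = m -> sorted leq C ->
  perm_eq u (iota 0 m) -> 0 < k <= 2 -> admissible k C (word_between u) ->
  exists X, step_class (far_content k C) m u X /\
  exists2 L, schur_expansion m X L & size L = 1.
Proof.
move=> m_range sizeC sortedC perm_u; case: k => [|[|[|k]]] // _; last first.
  exact: domino_pattern_expansion.
move=> /admissibleP adm; pose C2 := map double C.
have nthC2 p : p < m -> nth 0 C2 p = (nth 0 C p).*2 by move=> pm; rewrite (nth_map 0) ?sizeC.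
have szC2 : size C2 = m by rewrite size_map.
have srt2 : sorted leq C2 by apply: homo_sorted sortedC => x y; rewrite leq_double.
have adm2 : admissible 2 C2 (word_between u).
  apply/admissibleP => p q pq; rewrite szC2 => qm.
  rewrite !nthC2 ?(ltn_trans pq) // => /double_inj e.
  have [|[x [xm ex Rx]] [y [ym ey Ry]]] := adm p q pq _ e; first by rewrite sizeC.
  rewrite sizeC in xm ym.
  split; [exists x | exists y]; rewrite nthC2 //; split=> //; first by rewrite -ex; lia.
  by rewrite ey; lia.
have [X [clX LX]] := domino_pattern_expansion m_range szC2 srt2 perm_u adm2.
exists X; split=> //; apply: eq_step_class clX => // x y z xm ym zm _.
by rewrite /far_content !nthC2 //; lia.
Qed.

(** Three cells cannot contain four close ones: this gives a single Schur function for [h = i] and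
    every [k]. *)
Lemma short_bounds3 k C : size C = 3 -> short 0 (bounds_of k C).
Proof.
move=> sz; rewrite /bounds_of sz /= andbT /bound.
by have := count_size (fun x => x <= nth 0 C 0 + k) C; rewrite sz; lia.
Qed.

(** * Cells in reading order *)

Lemma partition_nth_le s i j : is_partition s -> i <= j -> nth 0 s j <= nth 0 s i.
Proof.
move=> /andP[srt _] le_ij; have [le_sj|lt_js] := leqP (size s) j; first by rewrite nth_default.
have geq_tr : transitive geq by move=> y x z /= xy yz; apply: leq_trans yz xy.
by apply: (sorted_leq_nth geq_tr leqnn 0 srt) => //; rewrite inE (leq_ltn_trans le_ij).
Qed.

Lemma mem_skew_cells s c :
  (c \in skew_cells s) = (nth 0 s.2 c.2 <= c.1 < nth 0 s.1 c.2).
Proof. by rewrite mem_filter !mem_diagram -leqNgt. Qed.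

(** Row lengths decrease upwards: row [y] of the outer shape is at least as long as row [c'.2], row
    [y] of the inner one at most as long as row [c.2]. *)
Lemma skew_cells_convex s c c' x y : is_skew_shape s ->
  c \in skew_cells s -> c' \in skew_cells s ->
  c.1 <= x <= c'.1 -> c.2 <= y <= c'.2 -> (x, y) \in skew_cells s.
Proof.
move=> /and3P[p1 p2 _]; rewrite !mem_skew_cells /= => cs c's x_in /andP[y1 y2].
by have := partition_nth_le p1 y2; have := partition_nth_le p2 y1; lia.
Qed.

Definition cell_at (k : nat) (mu : 'I_k -> seq nat * seq nat) (r : nat) :=
  nth cell0 (cells_of mu) (nth 0 (read_order mu) r).

Definition cont_at (k : nat) (mu : 'I_k -> seq nat * seq nat) (r : nat) : int :=
  scont k (cell_at mu r).

(** A relation between reading positions, independent of the filling, hence constant along a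
    class. *)
Definition far_at (k : nat) (mu : 'I_k -> seq nat * seq nat) : rel nat :=
  fun r s => k < absz (cont_at mu r - cont_at mu s)%R.

Definition positions (k : nat) (mu : 'I_k -> seq nat * seq nat) (t : seq nat) :=
  [seq index j (rword mu t) | j <- iota 1 (size (cells_of mu))].

Definition cell_prec (x y : nat * (nat * nat)) : bool :=
  (x.1 == y.1) && (((x.2.2 == y.2.2) && (x.2.1 < y.2.1)) ||
                   ((x.2.1 == y.2.1) && (x.2.2 < y.2.2))).

(** The strict product order, through which entries are compared for cells sharing neither row nor
    column. *)
Definition cell_dom (x y : nat * (nat * nat)) : bool :=
  [&& x.1 == y.1, x.2.1 <= y.2.1, x.2.2 <= y.2.2 & x != y].

Section Cells.
Variables (k : nat) (mu : 'I_k -> seq nat * seq nat).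

Local Notation cs := (cells_of mu).
Local Notation n := (size (cells_of mu)).
Local Notation ro := (read_order mu).
Local Notation cell := (cell_at mu).
Local Notation cont := (cont_at mu).

Lemma mem_cells_of (x : nat * (nat * nat)) : reflect (exists2 i : 'I_k, x.1 = i & x.2 \in skew_cells (mu i)) (x \in cs).
Proof.
case: x => a c; apply: (iffP flatten_mapP) => [[i _ /mapP[c' c'i [-> ->]]]|[i /= -> ci]].
  by exists i.
by exists i; rewrite ?mem_enum // map_f.
Qed.

Lemma uniq_cells_of : uniq cs.
Proof.
apply: (@allpairs_uniq_dep 'I_k (fun=> (nat * nat)%type) (nat * (nat * nat))%type
  (fun i c => (val i, c)) (enum 'I_k) (fun i => skew_cells (mu i))).
- exact: enum_uniq.
- by move=> i _; rewrite filter_uniq ?uniq_diagram.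
- by move=> [i c] [i' c'] _ _ /= [/val_inj -> ->].
Qed.

Lemma perm_read_order : perm_eq ro (iota 0 n).
Proof. by rewrite perm_sort. Qed.

Lemma size_read_order : size ro = n.
Proof. by rewrite (perm_size perm_read_order) size_iota. Qed.

Lemma uniq_read_order : uniq ro.
Proof. by rewrite (perm_uniq perm_read_order) iota_uniq. Qed.

Lemma nth_read_order_lt r : r < n -> nth 0 ro r < n.
Proof.
move=> rn; have : nth 0 ro r \in ro by rewrite mem_nth ?size_read_order.
by rewrite (perm_mem perm_read_order) mem_iota.
Qed.

Lemma cell_at_mem r : r < n -> cell r \in cs.
Proof. by move=> rn; rewrite mem_nth ?nth_read_order_lt. Qed.

Lemma cell_at_inj r s : r < n -> s < n -> cell r = cell s -> r = s.
Proof.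
move=> rn sn /eqP; rewrite nth_uniq ?nth_read_order_lt ?uniq_cells_of //.
by rewrite nth_uniq ?size_read_order ?uniq_read_order // => /eqP.
Qed.

Lemma cell_at_surj x : x \in cs -> exists2 r, r < n & cell r = x.
Proof.
move=> xcs; have ixn : index x cs < n by rewrite index_mem.
have ixr : index x cs \in ro by rewrite (perm_mem perm_read_order) mem_iota.
exists (index (index x cs) ro); first by rewrite -size_read_order index_mem.
by rewrite /cell_at !nth_index.
Qed.

Lemma read_order_lt r s : r < s -> s < n ->
  ((cont r < cont s)%R \/
   cont r = cont s /\ (cell r).2.2 <= (cell s).2.2).
Proof.
move=> rs sn.
pose rr p q := let x := nth cell0 cs p in let y := nth cell0 cs q in
  (scont k x < scont k y)%R || ((scont k x == scont k y) && (x.2.2 <= y.2.2)).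
have rr_total : total rr.
  move=> p q; rewrite /rr /=; case: (ltgtP (scont k _) (scont k _)) => //= _.
  exact: leq_total.
have rr_trans : transitive rr.
  move=> q p v; rewrite /rr /= => /orP[h|/andP[/eqP-> h]] /orP[h'|/andP[/eqP<- h']].
  - by rewrite (lt_trans h h').
  - by rewrite h.
  - by rewrite h'.
  - by rewrite eqxx (leq_trans h h') orbT.
have srt : sorted rr ro by apply: sort_sorted.
have : rr (nth 0 ro r) (nth 0 ro s).
  by apply: (sorted_ltn_nth rr_trans 0 srt) => //; rewrite inE size_read_order // (ltn_trans rs).
by rewrite /rr /= => /orP[|/andP[/eqP]]; [left | right].
Qed.

Lemma cont_at_le r s : r <= s -> s < n -> (cont r <= cont s)%R.
Proof.
rewrite leq_eqVlt => /predU1P[->|rs] sn; first by rewrite lexx.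
by have [/ltW //|[-> _]] := read_order_lt rs sn; rewrite lexx.
Qed.

(** Shifted contents in one component differ by multiples of [k], nonzero for two cells of a row or
    column. *)
Lemma cell_prec_cont r s : cell_prec (cell r) (cell s) ->
  k <= absz (cont r - cont s)%R.
Proof.
rewrite /cell_prec /cont_at /scont => /andP[/eqP-> /orP[]/andP[/eqP-> lt]].
  have -> : (k%:Z * ((cell r).2.1%:Z - (cell s).2.2%:Z) + (cell s).1%:Z -
    (k%:Z * ((cell s).2.1%:Z - (cell s).2.2%:Z) + (cell s).1%:Z) =
    - (k%:Z * ((cell s).2.1%:Z - (cell r).2.1%:Z)))%R by lia.
  by rewrite abszN abszM leq_pmulr // absz_gt0; lia.
have -> : (k%:Z * ((cell s).2.1%:Z - (cell r).2.2%:Z) + (cell s).1%:Z -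
    (k%:Z * ((cell s).2.1%:Z - (cell s).2.2%:Z) + (cell s).1%:Z) =
    (k%:Z * ((cell s).2.2%:Z - (cell r).2.2%:Z)))%R by lia.
by rewrite abszM leq_pmulr // absz_gt0; lia.
Qed.

Hypothesis k_gt0 : 0 < k.

(** The component index is below [k]: it is the remainder of the shifted content modulo [k]. *)
Lemma scont_inj x y : x \in cs -> y \in cs -> scont k x = scont k y ->
  x.1 = y.1 /\ (x.2.1%:Z - x.2.2%:Z = y.2.1%:Z - y.2.2%:Z)%R.
Proof.
move=> /mem_cells_of[i xi _] /mem_cells_of[j yj _]; rewrite /scont xi yj.
have := ltn_ord i; have := ltn_ord j.
move: (nat_of_ord i) (nat_of_ord j) (_ - _)%R (_ - _)%R => a b c d bk ak e.
have ecd : c = d by nia.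
by split=> //; move: e; rewrite ecd; lia.
Qed.

Hypothesis mu_skew : forall i : 'I_k, is_skew_shape (mu i).

Lemma cells_convex x y a b : x \in cs -> y \in cs -> x.1 = y.1 ->
  x.2.1 <= a <= y.2.1 -> x.2.2 <= b <= y.2.2 -> (x.1, (a, b)) \in cs.
Proof.
move=> /mem_cells_of[i xi xs] /mem_cells_of[j yj ys] exy ha hb.
have eij : j = i by apply: val_inj; rewrite /= -xi -yj exy.
apply/mem_cells_of; exists i => //=; rewrite eij in ys.
exact: skew_cells_convex (mu_skew i) xs ys ha hb.
Qed.

(* Two cells on a diagonal of one component are the corners of a rectangle of
   cells, which contains the neighbours of the lower one. *)
Lemma equal_cont_between r s : r < s -> s < n -> cont r = cont s ->
  exists x y, [/\ x < n, y < n, (cont x + k%:Z = cont r)%R,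
    (cont y = cont r + k%:Z)%R &
    [/\ cell_dom (cell r) (cell x), cell_dom (cell x) (cell s),
        cell_dom (cell r) (cell y) & cell_dom (cell y) (cell s)]].
Proof.
move=> rs sn e; have rn := ltn_trans rs sn.
have [|[_ le_row]] := read_order_lt rs sn; first by rewrite e ltxx.
have rcs := cell_at_mem rn; have scs := cell_at_mem sn.
have [e1 e2] := scont_inj rcs scs e.
have ne : cell r != cell s.
  by apply: contraTneq rs => /(cell_at_inj rn sn) ->; rewrite ltnn.
move: rcs scs e1 e2 ne le_row; rewrite /cont_at.
case Er: (cell r) => [i [a b]]; case Es: (cell s) => [j [c d]] /= rcs scs eij e2 ne bd.
subst j; have ltbd : b < d.
  rewrite ltn_neqAle bd andbT; apply: contraNneq ne => ebd.
  by apply/eqP; congr (_, (_, _)) => //; lia.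
have [x xn Ex] : exists2 x, x < n & cell x = (i, (a, b.+1)).
  by apply/cell_at_surj/(cells_convex rcs scs) => //=; lia.
have [y yn Ey] : exists2 y, y < n & cell y = (i, (a.+1, b)).
  by apply/cell_at_surj/(cells_convex rcs scs) => //=; lia.
exists x, y; rewrite Ex Ey /scont /cell_dom /= !eqxx !xpair_eqE; split=> //; try lia.
by split; lia.
Qed.

(** Neighbours in a row or column are at distance exactly [k], so the cell next to the first one is
    a new cell of the shape. *)
Lemma far_cell_between r s : r < n -> s < n -> cell_prec (cell r) (cell s) ->
  far_at mu r s -> exists x, [/\ x < n, cell_dom (cell r) (cell x)
                            & cell_dom (cell x) (cell s)].
Proof.
move=> rn sn; rewrite /far_at /cont_at.
have := cell_at_mem rn; have := cell_at_mem sn.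
case Er: (cell r) => [i [a b]]; case Es: (cell s) => [j [c d]] scs rcs.
rewrite /cell_prec /scont /= => /andP[/eqP eij]; subst j => /orP[]/andP[/eqP e lt] farrs.
  have ac : a.+1 < c.
    rewrite ltn_neqAle lt andbT; apply: contraTneq farrs => <-; rewrite e -leqNgt.
    by apply: eq_leq; apply/eqP; rewrite -eqz_nat; lia.
  have [x xn Ex] : exists2 x, x < n & cell x = (i, (a.+1, b)).
    by apply/cell_at_surj/(cells_convex rcs scs) => //=; lia.
  by exists x; rewrite Ex /cell_dom /= !eqxx !xpair_eqE; split=> //; lia.
have bd : b.+1 < d.
  rewrite ltn_neqAle lt andbT; apply: contraTneq farrs => <-; rewrite e -leqNgt.
  by apply: eq_leq; apply/eqP; rewrite -eqz_nat; lia.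
have [x xn Ex] : exists2 x, x < n & cell x = (i, (a, b.+1)).
  by apply/cell_at_surj/(cells_convex rcs scs) => //=; lia.
by exists x; rewrite Ex /cell_dom /= !eqxx !xpair_eqE; split=> //; lia.
Qed.

End Cells.

(** * The operators on reading words *)

Lemma nth_step far j u l : j.+2 < size u ->
  nth 0 (step far j u) l =
  let: (a, b, c) := move far (nth 0 u j) (nth 0 u j.+1) (nth 0 u j.+2) in
  if l == j then a else if l == j.+1 then b else if l == j.+2 then c else nth 0 u l.
Proof.
elim: j u l => [|j IH] [|x u] l //=.
  case: u => [|y [|z r]] //= _; case: move => [[a b] c].
  by case: l => [|[|[|l]]].
rewrite ltnS => lt_j; case: l => [|l] /=; first by case: move => [[a b] c].
by rewrite IH // !eqSS.
Qed.

Lemma eq_step_at far far' j u : j.+2 < size u ->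
  let x := nth 0 u j in let y := nth 0 u j.+1 in let z := nth 0 u j.+2 in
  move far x y z = move far' x y z -> step far j u = step far' j u.
Proof.
move=> lt_j x y z e; apply: (@eq_from_nth _ 0); rewrite ?size_step // => l _.
by rewrite !nth_step // -/x -/y -/z e.
Qed.

Lemma step_comm far i j u : i + 3 <= j ->
  step far i (step far j u) = step far j (step far i u).
Proof.
elim: i j u => [|i IH] [|j] [|x u] //=; last by rewrite addSn ltnS => /IH->.
case: j u => [|[|j]] [|y [|z r]] //= _.
by case: move => [[a b] c].
Qed.

Lemma index_map_can (f g : nat -> nat) (z : nat) w : cancel f g -> cancel g f ->
  index z (map f w) = index (g z) w.
Proof. by move=> fK gK; rewrite -{1}(gK z) index_map //; apply: can_inj fK. Qed.

Definition swapn (x y z : nat) := if z == x then y else if z == y then x else z.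

Lemma swapnK x y : involutive (swapn x y).
Proof. by move=> z; rewrite /swapn; do ![case: eqP => //=]; lia. Qed.

Lemma index_swapv x y z w : index z (swapv x y w) = index (swapn x y z) w.
Proof. exact: index_map_can (swapnK x y) (swapnK x y). Qed.

Definition cyclen (a b c z : nat) :=
  if z == a then b else if z == b then c else if z == c then a else z.

Lemma cyclenK a b c : uniq [:: a; b; c] -> cancel (cyclen a b c) (cyclen c b a).
Proof. by rewrite /= !inE /cyclen => un z; do ![case: eqP => //=]; lia. Qed.

Lemma index_cyclen a b c z w : uniq [:: a; b; c] ->
  index z (map (cyclen a b c) w) = index (cyclen c b a z) w.
Proof.
move=> un; apply: index_map_can; apply: cyclenK => //.
by move: un; rewrite /= !inE; lia.
Qed.

Lemma sort3 (f : nat -> nat) x y z a b c :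
  perm_eq [:: a; b; c] [:: x; y; z] -> f a < f b < f c ->
  sort (fun p q => f p <= f q) [:: x; y; z] = [:: a; b; c].
Proof.
move=> pe /andP[ab bc]; set le := fun p q => f p <= f q.
have inj : {in [:: a; b; c] &, injective f}.
  by move=> p q; rewrite !inE => /or3P[]/eqP-> /or3P[]/eqP-> // e; lia.
apply: (sorted_eq_in (leT := le)).
- by move=> q p r _ _ _; apply: leq_trans.
- move=> p q; rewrite !mem_sort -!(perm_mem pe) => pi qi; rewrite /le => h; apply: inj => //.
  by lia.
- by apply: sort_sorted => p q; apply: leq_total.
- by rewrite /= /le (ltnW ab) (ltnW bc).
by rewrite perm_sort perm_sym.
Qed.

Lemma cyclen_rev a b c z : b != c ->
  (if z == a then c else if z == b then a else if z == c then b else z) = cyclen a c b z.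
Proof.
move=> bc; rewrite /cyclen; case: (z == a) => //.
by have [->|_] := eqVneq z b; rewrite ?(negbTE bc).
Qed.

Section Words.
Variable n : nat.

Definition word_positions (w : seq nat) := [seq index j w | j <- iota 1 n].

Lemma size_word_positions w : size (word_positions w) = n.
Proof. by rewrite size_map size_iota. Qed.

Lemma nth_word_positions w l : l < n -> nth 0 (word_positions w) l = index l.+1 w.
Proof. by move=> ln; rewrite (nth_map 0) ?size_iota // nth_iota. Qed.

Variable w : seq nat.
Hypothesis perm_w : perm_eq w (iota 1 n).

Lemma mem_word j : (j \in w) = (0 < j <= n).
Proof. by rewrite (perm_mem perm_w) mem_iota; lia. Qed.

Lemma size_word : size w = n.
Proof. by rewrite (perm_size perm_w) size_iota. Qed.

Lemma uniq_word : uniq w.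
Proof. by rewrite (perm_uniq perm_w) iota_uniq. Qed.

Lemma index_word_inj j l : 0 < j <= n -> 0 < l <= n -> index j w = index l w -> j = l.
Proof.
rewrite -!mem_word => jw lw e.
by rewrite -(nth_index 0 jw) e nth_index.
Qed.

Lemma perm_word_positions : perm_eq (word_positions w) (iota 0 n).
Proof.
have un : uniq (word_positions w).
  rewrite map_inj_in_uniq ?iota_uniq // => i j; rewrite !mem_iota => ii jj.
  by apply: index_word_inj; lia.
apply: uniq_perm => //; first exact: iota_uniq.
have sub : {subset word_positions w <= iota 0 n}.
  move=> r /mapP[j]; rewrite mem_iota => jn ->.
  by rewrite mem_iota /= add0n -size_word index_mem mem_word; lia.
by have [|_ e] := uniq_min_size un sub; rewrite ?size_iota ?size_word_positions.
Qed.

Section Operators.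
Variable i : nat.
Hypothesis i_range : 1 < i < n.

Let pm := index i.-1 w.
Let p := index i w.
Let pp := index i.+1 w.

Let distinct : [/\ pm != p, p != pp & pm != pp].
Proof.
by split; apply/eqP => /index_word_inj; lia.
Qed.

Let posE : [/\ nth 0 (word_positions w) (i - 2) = pm,
  nth 0 (word_positions w) (i - 2).+1 = p & nth 0 (word_positions w) (i - 2).+2 = pp].
Proof.
split; rewrite nth_word_positions; try lia; congr (index _ w); lia.
Qed.

Let neqs : ((i.-1 == i = false) * (i.-1 == i.+1 = false) * (i == i.-1 = false) *
  (i == i.+1 = false) * (i.+1 == i.-1 = false) * (i.+1 == i = false))%type.
Proof. by do ![split]; lia. Qed.

Let step_nth far l : l < n -> nth 0 (step far (i - 2) (word_positions w)) l =
  let: (a, b, c) := move far pm p pp in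
  if l.+1 == i.-1 then a else if l.+1 == i then b else if l.+1 == i.+1 then c
  else index l.+1 w.
Proof.
move=> ln; rewrite nth_step ?size_word_positions; last by lia.
have [-> -> ->] := posE; rewrite nth_word_positions //.
case: move => [[a b] c].
have -> : (l == i - 2) = (l.+1 == i.-1) by lia.
have -> : (l == (i - 2).+1) = (l.+1 == i) by lia.
by have -> : (l == (i - 2).+2) = (l.+1 == i.+1) by lia.
Qed.

(** When [i] is not in the middle, the nearer of [i-1] and [i+1] lies between [i] and the farther
    one, so comparing distances amounts to finding the median. *)
Lemma word_positions_d_op :
  word_positions (d_op i w) = step (fun _ _ => true) (i - 2) (word_positions w).
Proof.
have [n1 n2 n3] := distinct.
apply: (@eq_from_nth _ 0); rewrite ?size_step ?size_word_positions // => l ln.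
rewrite step_nth // nth_word_positions // /d_op /move.
rewrite -[between i w]/(btw pm p pp).
case mid: (btw pm p pp).
  have [e|_] := eqVneq l.+1 i.-1; first by rewrite ?e ?neqs ?eqxx.
  have [e|_] := eqVneq l.+1 i; first by rewrite ?e ?neqs ?eqxx.
  by have [e|_] := eqVneq l.+1 i.+1; rewrite ?e ?neqs ?eqxx.
rewrite -/p -/pm -/pp /ndist.
case mid': (btw p pm pp).
  have -> : (p - pp + (pp - p) < p - pm + (pm - p)) = false.
    by move: mid'; rewrite /btw; lia.
  rewrite index_swapv /swapn.
  have [e|_] := eqVneq l.+1 i.-1; first by rewrite ?e !neqs.
  have [e|_] := eqVneq l.+1 i; first by rewrite ?e ?neqs ?eqxx.
  by have [e|_] := eqVneq l.+1 i.+1; rewrite ?e ?neqs ?eqxx.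
have -> : (p - pp + (pp - p) < p - pm + (pm - p)).
  by move: mid mid' n1 n2 n3; rewrite /btw; lia.
rewrite index_swapv /swapn.
have [e|_] := eqVneq l.+1 i.-1; first by rewrite ?e !neqs.
have [e|_] := eqVneq l.+1 i; first by rewrite ?e ?neqs ?eqxx.
by have [e|_] := eqVneq l.+1 i.+1; rewrite ?e ?neqs ?eqxx.
Qed.

Lemma word_positions_dt_op :
  word_positions (dt_op i w) = step (fun _ _ => false) (i - 2) (word_positions w).
Proof.
have [n1 n2 n3] := distinct.
apply: (@eq_from_nth _ 0); rewrite ?size_step ?size_word_positions // => l ln.
rewrite step_nth // nth_word_positions // /dt_op /move.
rewrite -[between i w]/(btw pm p pp).
case mid: (btw pm p pp).
  have [e|_] := eqVneq l.+1 i.-1; first by rewrite ?e ?neqs ?eqxx.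
  have [e|_] := eqVneq l.+1 i; first by rewrite ?e ?neqs ?eqxx.
  by have [e|_] := eqVneq l.+1 i.+1; rewrite ?e ?neqs ?eqxx.
(* In the first two orders [i-1] is the median, in the last two [i+1]. A cycle of the letters acts
   on positions by the reverse cycle. *)
have cases : [|| p < pm < pp, pp < pm < p, p < pp < pm | pm < pp < p].
  by move: mid; rewrite /btw; lia.
have mid' : btw p pm pp = (p < pm < pp) || (pp < pm < p) by [].
have sortE a b c : perm_eq [:: a; b; c] [:: i.-1; i; i.+1] ->
    index a w < index b w < index c w ->
    sort (fun x y => index x w <= index y w) [:: i.-1; i; i.+1] = [:: a; b; c].
  exact: sort3.
have un a b c : perm_eq [:: a; b; c] [:: i.-1; i; i.+1] -> uniq [:: a; b; c].
  by move=> /perm_uniq ->; rewrite /= !inE; lia.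
have fin a b c x y z : perm_eq [:: a; b; c] [:: i.-1; i; i.+1] ->
    [&& cyclen c b a i.-1 == x, cyclen c b a i == y & cyclen c b a i.+1 == z] ->
    index l.+1 (map (cyclen a b c) w) = if l.+1 == i.-1 then index x w
      else if l.+1 == i then index y w else if l.+1 == i.+1 then index z w else index l.+1 w.
  move=> pe /and3P[/eqP<- /eqP<- /eqP<-]; rewrite index_cyclen ?un //.
  have := perm_mem pe l.+1; rewrite !inE.
  have [e|_] := eqVneq l.+1 i.-1; first by rewrite ?e ?neqs ?eqxx.
  have [e|_] := eqVneq l.+1 i; first by rewrite ?e ?neqs ?eqxx.
  have [e|_] := eqVneq l.+1 i.+1; first by rewrite ?e ?neqs ?eqxx.
  by rewrite /cyclen; do ![case: eqP => //].
have fin_rev a b c x y z : perm_eq [:: a; b; c] [:: i.-1; i; i.+1] ->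
    [&& cyclen b c a i.-1 == x, cyclen b c a i == y & cyclen b c a i.+1 == z] ->
    index l.+1 (map (fun z => if z == a then c else if z == b then a
                              else if z == c then b else z) w)
    = if l.+1 == i.-1 then index x w
      else if l.+1 == i then index y w else if l.+1 == i.+1 then index z w else index l.+1 w.
  move=> pe e; have bc : b != c by have := un _ _ _ pe; rewrite /= !inE; lia.
  rewrite (eq_map (fun z => cyclen_rev a z bc)); apply: fin => //.
  by apply: perm_trans pe; rewrite perm_cons (perm_catC [:: c] [:: b]).
have pe1 : perm_eq [:: i; i.-1; i.+1] [:: i.-1; i; i.+1] by apply/seq.permP => P /=; lia.
have pe2 : perm_eq [:: i.+1; i.-1; i] [:: i.-1; i; i.+1] by apply/seq.permP => P /=; lia.
have pe3 : perm_eq [:: i; i.+1; i.-1] [:: i.-1; i; i.+1] by apply/seq.permP => P /=; lia.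
have pe4 : perm_eq [:: i.-1; i.+1; i] [:: i.-1; i; i.+1] by apply/seq.permP => P /=; lia.
rewrite mid'; case/or4P: cases => ord.
- rewrite (sortE _ _ _ pe1) //= ?eqxx.
  have -> : (p < pm < pp) || (pp < pm < p) by rewrite ord.
  by apply: (fin i i.-1 i.+1) => //; rewrite /cyclen !neqs ?eqxx.
- rewrite (sortE _ _ _ pe2) //= neqs.
  have -> : (p < pm < pp) || (pp < pm < p) by rewrite ord orbT.
  by apply: (fin_rev i.+1 i.-1 i) => //; rewrite /cyclen ?neqs ?eqxx.
- rewrite (sortE _ _ _ pe3) //= ?eqxx.
  have -> : (p < pm < pp) || (pp < pm < p) = false by move: ord; clear; lia.
  by apply: (fin i i.+1 i.-1) => //; rewrite /cyclen ?neqs ?eqxx.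
rewrite (sortE _ _ _ pe4) //= neqs.
have -> : (p < pm < pp) || (pp < pm < p) = false by move: ord; clear; lia.
by apply: (fin_rev i.-1 i.+1 i) => //; rewrite /cyclen ?neqs ?eqxx.
Qed.

End Operators.
End Words.

(** * The operators on standard fillings *)

Section Tableaux.
Variables (k : nat) (mu : 'I_k -> seq nat * seq nat).

Local Notation cs := (cells_of mu).
Local Notation n := (size (cells_of mu)).
Local Notation ro := (read_order mu).
Local Notation cell := (cell_at mu).
Local Notation cont := (cont_at mu).

Lemma nth_of_word w r : r < n -> nth 0 (of_word mu w) r = nth 0 w (index r ro).
Proof. by move=> rn; rewrite (nth_map 0) ?size_iota // nth_iota. Qed.

Lemma size_of_word w : size (of_word mu w) = n.
Proof. by rewrite size_map size_iota. Qed.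

Lemma rword_of_word w : size w = n -> rword mu (of_word mu w) = w.
Proof.
move=> sz; apply: (@eq_from_nth _ 0); first by rewrite size_map size_read_order sz.
rewrite size_map size_read_order => r rn.
rewrite (nth_map 0) ?size_read_order // nth_of_word ?nth_read_order_lt //.
by rewrite index_uniq ?size_read_order ?uniq_read_order.
Qed.

Lemma of_word_rword t : size t = n -> of_word mu (rword mu t) = t.
Proof.
move=> sz; apply: (@eq_from_nth _ 0); rewrite size_of_word ?sz // => r rn.
have r_ro : r \in ro by rewrite (perm_mem (perm_read_order mu)) mem_iota.
by rewrite nth_of_word // (nth_map 0) ?index_mem // nth_index.
Qed.

Lemma perm_rword t : size t = n -> perm_eq (rword mu t) t.
Proof.
move=> sz; rewrite -[X in perm_eq _ X](mkseq_nth 0 t) sz.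
exact/perm_map/perm_read_order.
Qed.

Section OneTableau.
Variable t : seq nat.
Hypothesis perm_t : perm_eq t (iota 1 n).

Let size_t : size t = n.
Proof. by rewrite (perm_size perm_t) size_iota. Qed.

Let perm_w : perm_eq (rword mu t) (iota 1 n).
Proof. exact: perm_trans (perm_rword size_t) perm_t. Qed.

Lemma perm_positions : perm_eq (positions mu t) (iota 0 n).
Proof. exact: perm_word_positions perm_w. Qed.

Lemma size_positions : size (positions mu t) = n.
Proof. exact: size_word_positions. Qed.

Lemma uniq_positions : uniq (positions mu t).
Proof. by rewrite (perm_uniq perm_positions) iota_uniq. Qed.

Lemma cell_of_index a : 0 < a <= n -> cell_of mu t a = cell (index a (rword mu t)).
Proof.
move=> an; rewrite /cell_of /cell_at; congr (nth _ _ _).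
have aw : a \in rword mu t by rewrite (mem_word perm_w).
have := nth_index 0 aw; have lt_i : index a (rword mu t) < n.
  by rewrite -(size_word perm_w) index_mem.
rewrite (nth_map 0) ?size_read_order // => {1}<-.
by rewrite index_uniq ?size_t ?nth_read_order_lt // (perm_uniq perm_t) iota_uniq.
Qed.

Lemma cell_of_positions j : j < n ->
  cell (nth 0 (positions mu t) j) = nth cell0 cs (index j.+1 t).
Proof.
by move=> jn; rewrite nth_word_positions // -cell_of_index //= jn.
Qed.

Lemma rword_D_op i : rword mu (D_op mu i t) =
  if k < dist3 mu t i then d_op i (rword mu t) else dt_op i (rword mu t).
Proof.
rewrite rword_of_word // /d_op /dt_op /swapv.
by do ![case: ifP => _]; rewrite ?size_map ?size_read_order.
Qed.

(** Contents increase weakly in reading order, so [dist3] is the distance of the two extreme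
    positions, the pair on which [step] consults [far_at]. *)
Lemma positions_D_op i : 1 < i < n ->
  positions mu (D_op mu i t) = step (far_at mu) (i - 2) (positions mu t).
Proof.
move=> i_range.
have -> : positions mu (D_op mu i t) = step (fun _ _ => k < dist3 mu t i) (i - 2) (positions mu t).
  rewrite /positions rword_D_op.
  by case: ifP => _; [exact: word_positions_d_op | exact: word_positions_dt_op].
apply: eq_step_at; first by rewrite size_positions; lia.
rewrite !nth_word_positions; try lia.
have -> : (i - 2).+1 = i.-1 by lia.
have -> : (i.-1).+1 = i by lia.
rewrite /dist3 /dist !cell_of_index; try lia.
rewrite -!/(cont _).
have lt_w j : 0 < j <= n -> index j (rword mu t) < n.
  by move=> jn; rewrite -(size_word perm_w) index_mem (mem_word perm_w).
have zn := lt_w i.+1; have yn := lt_w i; have xn := lt_w i.-1.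
have nxy : index i.-1 (rword mu t) != index i (rword mu t).
  by apply/eqP => /(index_word_inj perm_w); lia.
have nyz : index i (rword mu t) != index i.+1 (rword mu t).
  by apply/eqP => /(index_word_inj perm_w); lia.
have nxz : index i.-1 (rword mu t) != index i.+1 (rword mu t).
  by apply/eqP => /(index_word_inj perm_w); lia.
move: (index _ _) (index _ _) (index _ _) nxy nyz nxz zn yn xn => z y x nxy nyz nxz.
move=> /(_ ltac:(lia)) zn /(_ ltac:(lia)) yn /(_ ltac:(lia)) xn.
have le p q : p <= q -> p < n -> q < n -> (cont p <= cont q)%R.
  by move=> pq _ qn; apply: cont_at_le.
rewrite /move /far_at /btw.
case: ifP => c1 //; case: ifP => c2; congr (if _ then _ else _).
  by case/orP: c2 => /andP[/ltnW h1 /ltnW h2];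
    have := le _ _ h1; have := le _ _ h2; clear -xn yn zn; lia.
have : (x < z < y) || (y < z < x) by move: c1 c2 nxy nyz nxz; clear; lia.
by case/orP => /andP[/ltnW h1 /ltnW h2];
  have := le _ _ h1; have := le _ _ h2; clear -xn yn zn; lia.
Qed.

Definition position_standard (u : seq nat) : Prop :=
  forall j l, j < n -> l < n ->
    cell_prec (cell (nth 0 u j)) (cell (nth 0 u l)) -> j < l.

Lemma is_standardP : reflect (position_standard (positions mu t)) (is_standard mu t).
Proof.
have idx p : p < n -> [/\ 0 < nth 0 t p, (nth 0 t p).-1 < n & index (nth 0 t p) t = p].
  move=> pn; have : nth 0 t p \in t by rewrite mem_nth ?size_t.
  rewrite (mem_word perm_t) => tp; split; try lia.
  by rewrite index_uniq ?size_t // (perm_uniq perm_t) iota_uniq.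
apply: (iffP andP) => [[_ /allP std] j l jn ln|std].
  rewrite !cell_of_positions // => /andP[e1 e2].
  have tE a : a < n -> index a.+1 t < n /\ nth 0 t (index a.+1 t) = a.+1.
    by move=> an; rewrite -{1}size_t index_mem nth_index (mem_word perm_t).
  have [jt tj] := tE j jn; have [lt tl] := tE l ln.
  have := std (index j.+1 t); rewrite mem_iota jt => /(_ isT)/allP/(_ (index l.+1 t)).
  by rewrite mem_iota lt /= e1 e2 tj tl => /(_ isT).
split=> //; apply/allP => p; rewrite mem_iota /= add0n => pn.
apply/allP => q; rewrite mem_iota /= add0n => qn.
have [tp tpn ip] := idx p pn; have [tq tqn iq] := idx q qn.
apply/implyP => e1; apply/implyP => e2.
have := std _ _ tpn tqn; rewrite !cell_of_positions // !prednK // ip iq /cell_prec e1 e2.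
by move=> /(_ isT); lia.
Qed.

End OneTableau.

Lemma positions_inj t t' : perm_eq t (iota 1 n) -> perm_eq t' (iota 1 n) ->
  positions mu t = positions mu t' -> t = t'.
Proof.
move=> pt pt' e.
have sz s : perm_eq s (iota 1 n) -> size s = n by move/perm_size; rewrite size_iota.
rewrite -(of_word_rword (sz _ pt)) -(of_word_rword (sz _ pt')); congr of_word.
have pw := perm_trans (perm_rword (sz _ pt)) pt.
have pw' := perm_trans (perm_rword (sz _ pt')) pt'.
apply: (@eq_from_nth _ 0); rewrite (size_word pw) ?(size_word pw') // => r rn.
set a := nth 0 _ r; have aw : 0 < a <= n by rewrite -(mem_word pw) mem_nth ?(size_word pw).
have := congr1 (nth 0 ^~ a.-1) e; rewrite /= !nth_word_positions; try lia.
rewrite prednK; last by lia.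
rewrite index_uniq ?(size_word pw) ?(uniq_word pw) // => ->.
by rewrite nth_index // (mem_word pw').
Qed.

Lemma mem_SYT t : (t \in SYT mu) = is_standard mu t.
Proof.
rewrite mem_filter mem_permutations /is_standard.
by case: (perm_eq _ _); rewrite ?andbF ?andbT.
Qed.

Lemma SYT_perm t : t \in SYT mu -> perm_eq t (iota 1 n).
Proof. by rewrite mem_SYT => /andP[]. Qed.

Lemma SYTP t : t \in SYT mu <-> perm_eq t (iota 1 n) /\ position_standard (positions mu t).
Proof.
split=> [tS|[pt /(is_standardP pt)]]; last by rewrite mem_SYT.
by have pt := SYT_perm tS; split=> //; apply/is_standardP; rewrite -?mem_SYT.
Qed.

Hypothesis k_gt0 : 0 < k.
Hypothesis mu_skew : forall i : 'I_k, is_skew_shape (mu i).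

(** A content strictly between two contents at most [k] apart is less than [k] from both, while
    related cells are at least [k] apart. *)
Lemma near_unrelated r s q : btw r s q -> r < n -> s < n -> q < n ->
  far_at mu r q = false -> cont r <> cont s -> cont s <> cont q ->
  [/\ ~~ cell_prec (cell r) (cell s), ~~ cell_prec (cell s) (cell r),
      ~~ cell_prec (cell s) (cell q) & ~~ cell_prec (cell q) (cell s)].
Proof.
move=> rsq rn sn qn nf ne1 ne2.
have [lt1 lt2] : absz (cont r - cont s)%R < k /\ absz (cont s - cont q)%R < k.
  move: nf; rewrite /far_at; case/orP: rsq => /andP[h1 h2].
    have := cont_at_le (ltnW h1) sn; have := cont_at_le (ltnW h2) qn.
    by clear -ne1 ne2; lia.
  have := cont_at_le (ltnW h1) sn; have := cont_at_le (ltnW h2) rn.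
  by clear -ne1 ne2; lia.
have no p v : absz (cont p - cont v)%R < k -> ~~ cell_prec (cell p) (cell v).
  by move=> lt; apply/negP => /cell_prec_cont; rewrite leqNgt lt.
have distC p v : absz (cont p - cont v)%R = absz (cont v - cont p)%R by rewrite -abszN opprB.
by split; apply: no; rewrite // distC.
Qed.

Section Standard.
Variable u : seq nat.
Hypothesis perm_u : perm_eq u (iota 0 n).
Hypothesis std : position_standard u.

Let size_u : size u = n.
Proof. by rewrite (perm_size perm_u) size_iota. Qed.

Let nth_u_lt j : j < n -> nth 0 u j < n.
Proof.
move=> jn; have : nth 0 u j \in u by rewrite mem_nth ?size_u.
by rewrite (perm_mem perm_u) mem_iota.
Qed.

Lemma position_surj r : r < n -> exists2 j, j < n & nth 0 u j = r.
Proof.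
move=> rn; have ru : r \in u by rewrite (perm_mem perm_u) mem_iota.
by exists (index r u); rewrite ?nth_index // -size_u index_mem.
Qed.

(** If the cells share neither row nor column, pass through the corner in the column of the upper
    and the row of the lower cell, which convexity provides. *)
Lemma standard_dom j l : j < n -> l < n ->
  cell_dom (cell (nth 0 u j)) (cell (nth 0 u l)) -> j < l.
Proof.
move=> jn ln /and4P[e1 le1 le2 ne].
have [e2|ne2] := eqVneq (cell (nth 0 u j)).2.2 (cell (nth 0 u l)).2.2.
  apply: std => //; rewrite /cell_prec e1 e2 eqxx /= ltn_neqAle le1 andbT orbC.
  rewrite ltnn andbF /=; apply: contraNneq ne => e3; apply/eqP.
  move: e1 e2 e3; case: (cell (nth 0 u j)) => a [b c]; case: (cell (nth 0 u l)) => a' [b' c'] /=.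
  by move=> /eqP -> -> ->.
have [e3|ne3] := eqVneq (cell (nth 0 u j)).2.1 (cell (nth 0 u l)).2.1.
  by apply: std => //; rewrite /cell_prec e1 e3 eqxx /= (ltn_neqAle _.2.2) ne2 le2 orbT.
have cj := cell_at_mem (nth_u_lt jn); have cl := cell_at_mem (nth_u_lt ln).
have [r rn er] : exists2 r, r < n & cell r =
    ((cell (nth 0 u j)).1, ((cell (nth 0 u l)).2.1, (cell (nth 0 u j)).2.2)).
  apply/cell_at_surj/(cells_convex mu_skew cj cl (eqP e1)); first by rewrite le1 leqnn.
  by rewrite leqnn le2.
have [m mn em] := position_surj rn.
have jm : j < m.
  by apply: std => //; rewrite em er /cell_prec /= !eqxx ltn_neqAle ne3 le1.
apply: ltn_trans jm _; apply: std => //.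
by rewrite em er /cell_prec /= !eqxx (ltn_neqAle _.2.2) ne2 le2 e1 orbT.
Qed.

Lemma equal_cont_gap j l : j < n -> l < n -> nth 0 u j < nth 0 u l ->
  cont (nth 0 u j) = cont (nth 0 u l) ->
  exists a b, [/\ j < a < l, j < b < l, (cont (nth 0%N u a) + k%:Z = cont (nth 0%N u j))%R
    & (cont (nth 0%N u b) = cont (nth 0%N u j) + k%:Z)%R].
Proof.
move=> jn ln lt_jl e.
have [x [y [xn yn ex ey [d1 d2 d3 d4]]]] := equal_cont_between k_gt0 mu_skew lt_jl (nth_u_lt ln) e.
have [a an ea] := position_surj xn; have [b bn eb] := position_surj yn; subst x y.
by exists a, b; split=> //; apply/andP; split; apply: standard_dom.
Qed.

(** Equal contents would need two different entries in between, of contents [k] less and [k] more,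
    but there is room for one. *)
Lemma standard_close_distinct j l : j < l -> l <= j.+2 -> l < n ->
  cont (nth 0 u j) <> cont (nth 0 u l).
Proof.
move=> jl lj ln e; have jn := ltn_trans jl ln.
have [lt|ge|eq] := ltngtP (nth 0 u j) (nth 0 u l).
- have [a [b [ja jb ea eb]]] := equal_cont_gap jn ln lt e.
  have ab : a = b by lia.
  by subst b; lia.
- by have [a [b [ja jb _ _]]] := equal_cont_gap ln jn ge (esym e); lia.
have /eqP := eq; rewrite nth_uniq ?size_u // ?(perm_uniq perm_u) ?iota_uniq //; lia.
Qed.

(** A cell between the two would carry an entry strictly between consecutive ones. *)
Lemma standard_consecutive j : j.+1 < n ->
  cell_prec (cell (nth 0 u j)) (cell (nth 0 u j.+1)) ->
  ~~ far_at mu (nth 0 u j) (nth 0 u j.+1).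
Proof.
move=> jn prec; have jn' := ltnW jn; apply/negP => far.
have [x [xn d1 d2]] := far_cell_between k_gt0 mu_skew (nth_u_lt jn') (nth_u_lt jn) prec far.
have [a an ea] := position_surj xn; subst x.
by have := standard_dom jn' an d1; have := standard_dom an jn d2; lia.
Qed.

Lemma nth_neq j l : j < l -> l < n -> nth 0 u j != nth 0 u l.
Proof.
move=> jl ln; rewrite nth_uniq ?size_u ?(perm_uniq perm_u) ?iota_uniq ?(ltn_trans jl) //.
by rewrite neq_ltn jl.
Qed.

(** An index outside the triple lies before or after all three places, so only comparisons within
    the triple are at stake. *)
Lemma standard_replace a (x y z : nat) (f : nat -> nat) : a.+2 < n ->
  {subset [:: x; y; z] <= [:: nth 0 u a; nth 0 u a.+1; nth 0 u a.+2]} ->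
  ~~ cell_prec (cell y) (cell x) -> ~~ cell_prec (cell z) (cell x) ->
  ~~ cell_prec (cell z) (cell y) ->
  (forall l, f l = if l == a then x else if l == a.+1 then y
                   else if l == a.+2 then z else nth 0 u l) ->
  forall j l, j < n -> l < n -> cell_prec (cell (f j)) (cell (f l)) -> j < l.
Proof.
move=> an sub yx zx zy fE j l jn ln.
have irr r : cell_prec (cell r) (cell r) = false by rewrite /cell_prec !ltnn !andbF.
have tri v : v \in [:: x; y; z] -> exists j', [/\ a <= j', j' <= a.+2, j' < n & v = nth 0 u j'].
  by move=> /sub; rewrite !inE => /or3P[]/eqP->; [exists a | exists a.+1 | exists a.+2]; split; lia.
have [|jx [x1 x2 xn ex]] := tri x; first by rewrite !inE eqxx.
have [|jy [y1 y2 yn ey]] := tri y; first by rewrite !inE eqxx orbT.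
have [|jz [z1 z2 zn ez]] := tri z; first by rewrite !inE eqxx !orbT.
clear sub tri; rewrite !fE.
have [->|nja] := eqVneq j a.
  have [->|nla] := eqVneq l a; first by rewrite irr.
  have [->|nla1] := eqVneq l a.+1; first by move=> _; apply: ltnSn.
  have [->|nla2] := eqVneq l a.+2; first by move=> _; apply: leqnSn.
  by rewrite ex => /(std xn ln); clear -x1 x2 nla nla1 nla2; lia.
have [->|nja1] := eqVneq j a.+1.
  have [->|nla] := eqVneq l a; first by rewrite (negbTE yx).
  have [->|nla1] := eqVneq l a.+1; first by rewrite irr.
  have [->|nla2] := eqVneq l a.+2; first by move=> _; apply: ltnSn.
  by rewrite ey => /(std yn ln); clear -y1 y2 nla nla1 nla2; lia.
have [->|nja2] := eqVneq j a.+2.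
  have [->|nla] := eqVneq l a; first by rewrite (negbTE zx).
  have [->|nla1] := eqVneq l a.+1; first by rewrite (negbTE zy).
  have [->|nla2] := eqVneq l a.+2; first by rewrite irr.
  by rewrite ez => /(std zn ln); clear -z1 z2 nla nla1 nla2; lia.
have [->|nla] := eqVneq l a.
  by rewrite ex => /(std jn xn); clear -x1 x2 nja nja1 nja2; lia.
have [->|nla1] := eqVneq l a.+1.
  by rewrite ey => /(std jn yn); clear -y1 y2 nja nja1 nja2; lia.
have [->|nla2] := eqVneq l a.+2.
  by rewrite ez => /(std jn zn); clear -z1 z2 nja nja1 nja2; lia.
exact: std.
Qed.

(* Cells with consecutive entries that are exchanged are never comparable: in
   the far case they are not adjacent, and in the near case the middle cell is
   at distance less than [k] from the two others. *)
Lemma standard_step a : a.+2 < n -> position_standard (step (far_at mu) a u).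
Proof.
move=> a2n; have a1n := ltnW a2n; have a0n := ltnW a1n.
have sub3 : let: (x', y', z') := move (far_at mu) (nth 0 u a) (nth 0 u a.+1) (nth 0 u a.+2) in
    {subset [:: x'; y'; z'] <= [:: nth 0 u a; nth 0 u a.+1; nth 0 u a.+2]}.
  have := move_perm (far_at mu) (nth 0 u a) (nth 0 u a.+1) (nth 0 u a.+2) [::].
  by case: move => [[x' y'] z'] /perm_mem e v; rewrite e.
have stepE l : nth 0 (step (far_at mu) a u) l =
    let: (x', y', z') := move (far_at mu) (nth 0 u a) (nth 0 u a.+1) (nth 0 u a.+2) in
    if l == a then x' else if l == a.+1 then y' else if l == a.+2 then z' else nth 0 u l.
  by rewrite nth_step // size_u.
suff : let: (x', y', z') := move (far_at mu) (nth 0 u a) (nth 0 u a.+1) (nth 0 u a.+2) in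
    [/\ ~~ cell_prec (cell y') (cell x'), ~~ cell_prec (cell z') (cell x')
      & ~~ cell_prec (cell z') (cell y')].
  move: sub3 stepE; case: move => [[x' y'] z'] sub3 stepE [k1 k2 k3].
  exact: standard_replace stepE.
clear sub3 stepE.
have nxy := nth_neq (ltnSn a) a1n; have nyz := nth_neq (ltnSn a.+1) a2n.
have nxz := nth_neq (leqnSn a.+1) a2n.
have cxy := standard_close_distinct (ltnSn a) (leqnSn a.+1) a1n.
have cyz := standard_close_distinct (ltnSn a.+1) (leqnSn a.+2) a2n.
have cxz := standard_close_distinct (leqnSn a.+1) (leqnn a.+2) a2n.
have fxy := contraL (standard_consecutive a1n).
have fyz := contraL (standard_consecutive a2n).
have nyx : ~~ cell_prec (cell (nth 0 u a.+1)) (cell (nth 0 u a)).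
  by apply/negP => /(std a1n a0n); rewrite ltnNge leqnSn.
have nzx : ~~ cell_prec (cell (nth 0 u a.+2)) (cell (nth 0 u a)).
  by apply/negP => /(std a2n a0n); rewrite ltnNge (leqW (leqnSn _)).
have nzy : ~~ cell_prec (cell (nth 0 u a.+2)) (cell (nth 0 u a.+1)).
  by apply/negP => /(std a2n a1n); rewrite ltnNge leqnSn.
move: (nth_u_lt a0n) (nth_u_lt a1n) (nth_u_lt a2n) nxy nyz nxz cxy cyz cxz fxy fyz nyx nzx nzy.
move: (nth 0 u a) (nth 0 u a.+1) (nth 0 u a.+2) => x y z xn yn zn nxy nyz nxz.
move=> cxy cyz cxz fxy fyz nyx nzx nzy.
rewrite /move; case: ifP => b1 //; case: ifP => b2; case: ifP => f //.
- by split=> //; apply: fyz.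
- by have [] := near_unrelated b2 yn xn zn f (nesym cxy) cxz.
- by split=> //; apply: fxy.
have b3 : btw x z y by move: b1 b2 nxy nyz nxz; clear; rewrite /btw; lia.
by have [] := near_unrelated b3 xn zn yn f cxz (nesym cyz).
Qed.

End Standard.
Lemma D_op_SYT i t : t \in SYT mu -> 1 < i < n -> D_op mu i t \in SYT mu.
Proof.
move=> /SYTP[pt std] i_range; have pD : perm_eq (D_op mu i t) (iota 1 n).
  have szt : size t = n by rewrite (perm_size pt) size_iota.
  have pw : perm_eq (rword mu t) (iota 1 n) by apply: perm_trans (perm_rword szt) pt.
  have pDw : perm_eq (D_op mu i t) (rword mu (D_op mu i t)).
    by rewrite perm_sym perm_rword // size_of_word.
  apply: perm_trans pDw _.
  have szw : size (rword mu (D_op mu i t)) = n by rewrite size_map size_read_order.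
  (* A missing entry would have index [n], whereas the positions are a permutation of
     [0, ..., n-1]. *)
  have sub : {subset iota 1 n <= rword mu (D_op mu i t)}.
    move=> j; rewrite mem_iota => jn; rewrite -index_mem szw.
    have := perm_mem (step_perm (far_at mu) (i - 2) (positions mu t)) (index j (rword mu (D_op mu i t))).
    rewrite -positions_D_op // (perm_mem (perm_positions pt)) mem_iota /= => <-.
    by apply: map_f; rewrite mem_iota.
  have [|e1 e2] := uniq_min_size (iota_uniq 1 n) sub; first by rewrite szw size_iota.
  by rewrite perm_sym uniq_perm ?iota_uniq // -(eq_uniq e1 e2) iota_uniq.
apply/SYTP; split=> //; rewrite positions_D_op //.
by apply: standard_step => //; [exact: perm_positions | lia].
Qed.

Lemma far_at_sym : symmetric (far_at mu).
Proof. by move=> p q; rewrite /far_at -abszN opprB. Qed.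

Lemma D_op_involutive i t : t \in SYT mu -> 1 < i < n -> D_op mu i (D_op mu i t) = t.
Proof.
move=> tS i_range; have DS := D_op_SYT tS i_range.
have pt := SYT_perm tS; have pD := SYT_perm DS.
apply: positions_inj => //; first exact/SYT_perm/D_op_SYT.
rewrite !positions_D_op // step_involutive //; first exact: far_at_sym.
exact: uniq_positions.
Qed.

Lemma D_op_comm i j t : t \in SYT mu -> 1 < i < n -> 1 < j < n -> 3 <= ndist i j ->
  D_op mu i (D_op mu j t) = D_op mu j (D_op mu i t).
Proof.
move=> tS i_range j_range; rewrite /ndist => ij.
have DiS := D_op_SYT tS i_range; have DjS := D_op_SYT tS j_range.
have pt := SYT_perm tS; have pi := SYT_perm DiS; have pj := SYT_perm DjS.
apply: positions_inj; [exact/SYT_perm/D_op_SYT | exact/SYT_perm/D_op_SYT |].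
rewrite !positions_D_op //; case: (leqP i j) => le.
  by apply: step_comm; lia.
by apply/esym/step_comm; lia.
Qed.

End Tableaux.

(** * Windows of consecutive entries *)

Lemma step_cat_left far (a w : seq nat) l : step far (size a + l) (a ++ w) = a ++ step far l w.
Proof. by elim: a => //= x a ->. Qed.

Lemma step_cat_right far (v b : seq nat) l : l.+2 < size v ->
  step far l (v ++ b) = step far l v ++ b.
Proof.
elim: l v => [|l IH] [|x v] //=; last by rewrite ltnS => /IH ->.
by case: v => [|y [|z v]] //= _; case: move => [[? ?] ?].
Qed.

Lemma step_map far far' (f : nat -> nat) l v :
  {in v &, {mono f : x y / x < y}} -> {in v &, forall x y, far x y = far' (f x) (f y)} ->
  step far' l (map f v) = map f (step far l v).
Proof.
elim: l v => [|l IH] [|x v] //= f_lt f_far; last first.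
  by rewrite IH // => p q pv qv; [apply: f_lt | apply: f_far]; rewrite inE ?pv ?qv orbT.
case: v f_lt f_far => [|y [|z v]] //= f_lt f_far; rewrite /move /btw.
by rewrite !f_lt ?f_far ?inE ?eqxx ?orbT //; do ![case: ifP => _].
Qed.

Lemma eq_Qcoef m D D' N (a : 'I_N -> nat) : (forall q, 0 < q < m -> D q = D' q) ->
  Qcoef m D N a = Qcoef m D' N a.
Proof.
move=> e; apply: eq_card => f; rewrite !inE; congr (_ && _).
apply: eq_forallb => p; apply: eq_forallb => q.
case: (eqVneq (val q) (val p).+1) => //= eq; have q_range : 0 < val q < m by rewrite ltn_ord andbT [val q]eq.
by rewrite (e _ q_range).
Qed.

Lemma schur_expansion_sum m X L N (a : 'I_N -> nat) : schur_expansion m X L ->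
  \sum_(v <- X) Qcoef m (des_of (dcode v)) N a = \sum_(la <- L) schur_coef la N a.
Proof.
move=> [/allP parts pe]; rewrite -(big_map dcode xpredT (fun c => Qcoef m (des_of c) N a)).
rewrite (perm_big _ pe) big_flatten big_map big_seq [RHS]big_seq.
apply: eq_bigr => la laL; have /andP[_ /eqP e] := parts _ laL.
by rewrite schur_coef_expansion size_diagram e.
Qed.

Lemma connect_invariant (T : finType) (e : rel T) (Q : T -> Prop) x y :
  Q x -> (forall y z, Q y -> e y z -> Q z) -> connect e x y -> Q y.
Proof.
move=> Qx Qe /connectP[p pth ->]; elim: p x Qx pth => //= z p IH x Qx /andP[xz].
exact/IH/(Qe _ _ Qx xz).
Qed.

Section Window.
Variables (k : nat) (mu : 'I_k -> seq nat * seq nat).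
Hypothesis k_gt0 : 0 < k.
Hypothesis mu_skew : forall i : 'I_k, is_skew_shape (mu i).

Local Notation n := (size (cells_of mu)).
Local Notation cont := (cont_at mu).

Variables h i : nat.
Hypothesis h_gt1 : 1 < h.
Hypothesis h_le_i : h <= i.
Hypothesis i_lt_n : i < n.
Hypothesis ih_le3 : i - h <= 3.

Local Notation m := (i - h + 3).
Local Notation o := (h - 2).

(** The entries [h-1, ..., i+1], those that [D_h, ..., D_i] move; entry [e] has index [e-1], hence
    the offset [h-2]. *)
Definition window (t : seq nat) : seq nat := take m (drop o (positions mu t)).

Lemma positions_window t : positions mu t =
  take o (positions mu t) ++ window t ++ drop (o + m) (positions mu t).
Proof. by rewrite /window (addnC o) -drop_drop !cat_take_drop. Qed.

Lemma size_window t : size (window t) = m.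
Proof.
rewrite size_take_min size_drop size_positions.
by clear -h_gt1 h_le_i i_lt_n; lia.
Qed.

Lemma nth_window t l : l < m -> nth 0 (window t) l = nth 0 (positions mu t) (o + l).
Proof. by move=> lm; rewrite nth_take // nth_drop. Qed.

Lemma window_D_op t j : t \in SYT mu -> h <= j <= i ->
  positions mu (D_op mu j t) =
  take o (positions mu t) ++ step (far_at mu) (j - h) (window t) ++ drop (o + m) (positions mu t).
Proof.
move=> /SYT_perm pt j_range; rewrite positions_D_op //; last by lia.
rewrite {1}positions_window -step_cat_right; last by rewrite size_window; lia.
rewrite -step_cat_left size_takel; last by rewrite size_positions; lia.
by congr step; lia.
Qed.

Variable t0 : seq nat.
Hypothesis t0_SYT : t0 \in SYT mu.

(** Ranks and contents from [t0] serve its whole class, which permutes the same reading positions.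
    Contents are translated by the first one to become natural numbers. *)
Let S := sort leq (window t0).
Let C := [seq absz (cont r - cont (nth 0%N S 0%N))%R | r <- S].
Let pat t := map (index^~ S) (window t).

Let perm_t0 := SYT_perm t0_SYT.

Let uniq_window : uniq (window t0).
Proof. by apply/take_uniq/drop_uniq/uniq_positions. Qed.

Let size_S : size S = m.
Proof. by rewrite size_sort size_window. Qed.

Let S_sorted : sorted ltn S.
Proof. by rewrite ltn_sorted_uniq_leq sort_uniq uniq_window sort_sorted //; apply: leq_total. Qed.

Let in_S r : (r \in S) = (r \in window t0).
Proof. exact: mem_sort. Qed.

Let S_lt_n r : r \in S -> r < n.
Proof.
rewrite in_S => /mem_take/mem_drop; rewrite (perm_mem (perm_positions perm_t0)) mem_iota.
by [].
Qed.

Let uniq_S : uniq S.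
Proof. by rewrite sort_uniq. Qed.

Let nth_S_lt p q : p < q -> q < m -> nth 0 S p < nth 0 S q.
Proof.
by move=> pq qm; apply: (sorted_ltn_nth ltn_trans 0 S_sorted) => //; rewrite inE size_S // (ltn_trans pq).
Qed.

Let index_S_mono : {in S &, {mono (index^~ S) : r s / r < s}}.
Proof.
move=> r s rS sS /=; have := nth_index 0 rS; have := nth_index 0 sS.
have : index s S < m by rewrite -size_S index_mem.
have : index r S < m by rewrite -size_S index_mem.
move: (index r S) (index s S) => p q pm qm <- <-.
case: (ltngtP p q) => [pq|qp|->]; last by rewrite ltnn.
  by rewrite nth_S_lt.
by apply/esym/negbTE; rewrite -leqNgt ltnW // nth_S_lt.
Qed.

Let cont_S_le p q : p <= q -> q < m -> (cont (nth 0%N S p) <= cont (nth 0%N S q))%R.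
Proof.
move=> pq qm; apply: cont_at_le; last by rewrite S_lt_n // mem_nth ?size_S.
by move: pq; rewrite leq_eqVlt => /predU1P[->//|pq]; rewrite ltnW // nth_S_lt.
Qed.

Let size_C : size C = m.
Proof. by rewrite size_map size_S. Qed.

Let nth_C p : p < m -> nth 0 C p = absz (cont (nth 0%N S p) - cont (nth 0%N S 0%N))%R.
Proof. by move=> pm; rewrite (nth_map 0) ?size_S. Qed.

Let posz_C p : p < m -> ((nth 0%N C p)%:Z = cont (nth 0%N S p) - cont (nth 0%N S 0%N))%R.
Proof.
move=> pm; rewrite nth_C //; have := cont_S_le (leq0n p) pm; clear; lia.
Qed.

Let C_sorted : sorted leq C.
Proof.
apply/(sortedP 0) => p; rewrite size_C => pm.
have := cont_S_le (leqnSn p) pm; have := posz_C pm; have := posz_C (ltnW pm).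
by clear; lia.
Qed.

Let far_S : {in S &, forall r s, far_at mu r s = far_content k C (index r S) (index s S)}.
Proof.
move=> r s rS sS; have er := nth_index 0 rS; have es := nth_index 0 sS.
have pm : index r S < m by rewrite -size_S index_mem.
have qm : index s S < m by rewrite -size_S index_mem.
rewrite /far_at /far_content; have := posz_C pm; have := posz_C qm; rewrite er es.
by move: (nth 0 C _) (nth 0 C _); clear => a b; lia.
Qed.

Definition in_window_class (t : seq nat) : Prop :=
  [/\ t \in SYT mu, perm_eq (window t) (window t0),
      take o (positions mu t) = take o (positions mu t0)
    & drop (o + m) (positions mu t) = drop (o + m) (positions mu t0)].

Lemma in_window_class0 : in_window_class t0.
Proof. by split. Qed.

Lemma in_window_class_step t j : in_window_class t -> h <= j <= i ->
  in_window_class (D_op mu j t) /\ pat (D_op mu j t) = step (far_content k C) (j - h) (pat t).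
Proof.
move=> [tS pw e1 e2] j_range; have := window_D_op tS j_range.
set a := take _ _; set b := drop _ _; set v := step _ _ _ => eD.
have szv : size v = m by rewrite size_step size_window.
have sza : size a = o.
  by rewrite size_takel // size_positions; clear -h_gt1 h_le_i i_lt_n; lia.
have wD : window (D_op mu j t) = v by rewrite /window eD -sza drop_size_cat // -szv take_size_cat.
split; last first.
  rewrite /pat wD; symmetry; apply: step_map => r s; rewrite !(perm_mem pw) -!in_S => rS sS.
    exact: index_S_mono.
  exact: far_S.
split.
- by apply: D_op_SYT => //; clear -h_gt1 i_lt_n j_range; lia.
- by rewrite wD; apply: perm_trans (step_perm _ _ _) pw.
- by rewrite eD -sza take_size_cat // sza.
by rewrite eD catA -{1}sza -{1}szv -size_cat drop_size_cat.
Qed.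

Lemma pat_inj t t' : in_window_class t -> in_window_class t' -> pat t = pat t' -> t = t'.
Proof.
move=> [tS pw e1 e2] [tS' pw' e1' e2'] e.
apply: (positions_inj (SYT_perm tS) (SYT_perm tS')).
rewrite positions_window [RHS]positions_window e1 e1' e2 e2'; congr (_ ++ (_ ++ _)).
have nthS t1 : perm_eq (window t1) (window t0) -> map (nth 0 S) (pat t1) = window t1.
  move=> p1; rewrite -map_comp -[RHS]map_id; apply/eq_in_map => r.
  by rewrite (perm_mem p1) -in_S /= => /nth_index ->.
by rewrite -(nthS t) // -(nthS t') // e.
Qed.

Lemma perm_pat : perm_eq (pat t0) (iota 0 m).
Proof.
have -> : iota 0 m = map (index^~ S) S.
  apply: (@eq_from_nth _ 0); rewrite size_iota ?size_map ?size_S // => p pm.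
  by rewrite nth_iota // (nth_map 0) ?size_S // index_uniq ?size_S.
by apply: perm_map; rewrite perm_sym perm_sort.
Qed.

Lemma Des_pat t q : in_window_class t -> 0 < q < m ->
  Des_hi (DesSYT mu) h i t q = des_of (dcode (pat t)) q.
Proof.
move=> [tS pw _ _] /andP[q0 qm]; rewrite /Des_hi /DesSYT /sigma_pos.
have q'm : q.-1 < m by apply: leq_ltn_trans qm; apply: leq_pred.
rewrite /des_of nth_dcode ?size_map ?size_window prednK //.
have win_S l : l < m -> nth 0 (window t) l \in S.
  by move=> lm; rewrite in_S -(perm_mem pw) mem_nth ?size_window.
rewrite !(nth_map 0) ?size_window // index_S_mono ?win_S // !nth_window //.
rewrite !nth_word_positions; try by clear -h_gt1 h_le_i i_lt_n qm q0; lia.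
have -> : (o + q.-1).+1 = q + h - 2 by clear -h_gt1 q0; lia.
have -> : (o + q).+1 = (q + h - 2).+1 by clear -h_gt1 q0; lia.
have -> : 0 < q <= i - h + 2 by clear -q0 qm; lia.
have -> : 0 < q + h - 2 < n by clear -h_gt1 h_le_i i_lt_n qm q0; lia.
have pt := SYT_perm tS; have szt : size t = n by rewrite (perm_size pt) size_iota.
have pw' := perm_trans (perm_rword szt) pt.
have : index (q + h - 2) (rword mu t) != index (q + h - 2).+1 (rword mu t).
  by apply/eqP => /(index_word_inj pw'); clear -h_gt1 h_le_i i_lt_n qm q0; lia.
by clear; lia.
Qed.

(** The separating cells carry entries between those of the two given cells, and the window is an
    interval of entries, so it contains them. *)
Lemma admissible_pat : admissible k C (word_between (pat t0)).
Proof.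
apply/admissibleP => p q pq; rewrite size_C => qm e.
have pm := ltn_trans pq qm.
have [_ std] := (SYTP mu t0).1 t0_SYT.
have pos r : r < m -> exists2 l, l < m & nth 0 (positions mu t0) (o + l) = nth 0 S r.
  move=> rm; have rw : nth 0 S r \in window t0 by rewrite -in_S mem_nth ?size_S.
  exists (index (nth 0 S r) (window t0)); first by rewrite -(size_window t0) index_mem.
  by rewrite -nth_window ?nth_index // -(size_window t0) index_mem.
have idx l : l < m -> index (index (nth 0 (positions mu t0) (o + l)) S) (pat t0) = l.
  move=> lm; rewrite -nth_window // -(nth_map 0 0 (index^~ S)) ?size_window //.
  by rewrite index_uniq ?size_map ?size_window // (perm_uniq perm_pat) iota_uniq.
have [j jm ej] := pos p pm; have [l lm el] := pos q qm.
have idp : index p (pat t0) = j by rewrite -[RHS](idx _ jm) ej index_uniq ?size_S.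
have idq : index q (pat t0) = l by rewrite -[RHS](idx _ lm) el index_uniq ?size_S.
have om : o + m <= n by clear -h_gt1 h_le_i i_lt_n; lia.
have e' : cont (nth 0 S p) = cont (nth 0 S q).
  by have := posz_C pm; have := posz_C qm; rewrite e; clear; lia.
have [||||a [b [ja jb ea eb]]] := @equal_cont_gap k mu k_gt0 mu_skew _ (perm_positions perm_t0) std (o + j) (o + l).
- by clear -jm om; lia.
- by clear -lm om; lia.
- by rewrite ej el nth_S_lt.
- by rewrite ej el.
have in_win c : o + j < c < o + l -> exists2 l', c = o + l' & j < l' < l /\ l' < m.
  by move=> c_range; exists (c - o); clear -c_range lm; lia.
have [a' ea' [a1 am]] := in_win a ja; have [b' eb' [b1 bm]] := in_win b jb; subst a b.
have rank l' : l' < m -> exists2 r, r < m & nth 0 S r = nth 0 (positions mu t0) (o + l') /\ index r (pat t0) = l'.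
  move=> lm'; exists (index (nth 0 (positions mu t0) (o + l')) S); last first.
    by split; [rewrite nth_index // in_S -nth_window // mem_nth ?size_window | exact: idx].
  by rewrite -size_S index_mem in_S -nth_window // mem_nth ?size_window.
have [x xm [ex ix]] := rank a' am; have [y ym [ey iy]] := rank b' bm.
rewrite -ex ej in ea; rewrite -ey ej in eb.
split; [exists x | exists y]; rewrite /word_between ?ix ?iy idp idq; split=> //.
  by have := posz_C xm; have := posz_C pm; clear -ea; lia.
by have := posz_C ym; have := posz_C pm; clear -eb; lia.
Qed.

Local Notation A := (SYT mu).
Local Notation class x := (connect (@gen_rel _ A (D_op mu) h i) x).

Lemma gen_rel_D_op (y z : seq_sub A) : @gen_rel _ A (D_op mu) h i y z ->
  exists2 j, h <= j <= i & D_op mu j (ssval y) = ssval z.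
Proof.
move=> /hasP[j]; rewrite mem_index_iota ltnS => j_range e; exists j => //.
have j_n : 1 < j < n by move: j_range; clear -h_gt1 i_lt_n; lia.
case/orP: e => /eqP // <-.
by apply: D_op_involutive => //; apply: ssvalP.
Qed.

Lemma gen_rel_mem (y : seq_sub A) j : h <= j <= i ->
  exists2 z : seq_sub A, @gen_rel _ A (D_op mu) h i y z & ssval z = D_op mu j (ssval y).
Proof.
move=> j_range; have j_n : 1 < j < n by move: j_range; clear -h_gt1 i_lt_n; lia.
have DA := D_op_SYT k_gt0 mu_skew (ssvalP y) j_n; exists (SeqSub DA) => //.
by apply/hasP; exists j; rewrite ?mem_index_iota ?ltnS // eqxx.
Qed.

(** [pat] maps the class bijectively onto [X]: into by closure, onto by induction over steps,
    injectively since all members agree outside the window. *)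
Lemma class_Q_pattern (x : seq_sub A) X N (a : 'I_N -> nat) : ssval x = t0 ->
  step_class (far_content k C) m (pat t0) X ->
  class_Q (DesSYT mu) (D_op mu) h i x a = \sum_(v <- X) Qcoef m (des_of (dcode v)) N a.
Proof.
move=> xt0 [patX uniqX closed reach].
have inv y : class x y -> in_window_class (ssval y) /\ pat (ssval y) \in X.
  apply: (connect_invariant (Q := fun y => in_window_class (ssval y) /\ pat (ssval y) \in X)).
    by rewrite xt0; split=> //; apply: in_window_class0.
  move=> {}y z [wy patyX] /gen_rel_D_op[j j_range <-].
  have [wD ->] := in_window_class_step wy j_range; split=> //.
  by apply: closed => //; move: j_range; clear; lia.
have surj v : v \in X -> exists2 y, class x y & pat (ssval y) = v.
  apply: (reach (fun v => exists2 y, class x y & pat (ssval y) = v)).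
    by exists x; rewrite ?connect0 // xt0.
  move=> {}v l lm [y xy <-].
  have j_range : h <= h + l <= i by move: lm h_le_i; clear; lia.
  have [z yz ez] := gen_rel_mem y j_range; exists z.
    exact: connect_trans xy (connect1 yz).
  have [_] := in_window_class_step (inv y xy).1 j_range; rewrite ez => ->.
  by rewrite addKn.
have pe : perm_eq [seq pat (ssval y) | y <- enum (class x)] X.
  apply: uniq_perm => // [|v].
    rewrite map_inj_in_uniq ?enum_uniq // => y z; rewrite !mem_enum => xy xz e.
    by apply: val_inj; apply: pat_inj e; [exact: (inv y xy).1 | exact: (inv z xz).1].
  apply/mapP/idP => [[y]|/surj[y xy <-]]; last by exists y; rewrite ?mem_enum.
  by rewrite mem_enum => /inv[_ yX] ->.
rewrite -(perm_big _ pe) big_map big_enum; apply: eq_bigr => y xy.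
by apply: eq_Qcoef => q qm; apply: Des_pat => //; exact: (inv y xy).1.
Qed.

Lemma window_schur (x : seq_sub A) : ssval x = t0 ->
  exists L, [/\ all (fun la => is_partition la && (sumn la == m)) L,
    h = i \/ k <= 2 -> size L = 1
    & forall N (a : 'I_N -> nat),
        class_Q (DesSYT mu) (D_op mu) h i x a = \sum_(la <- L) schur_coef la N a].
Proof.
move=> xt0; have m_range : 3 <= m <= 6 by move: ih_le3; clear; lia.
have use X L : step_class (far_content k C) m (pat t0) X -> schur_expansion m X L ->
    forall N (a : 'I_N -> nat),
      class_Q (DesSYT mu) (D_op mu) h i x a = \sum_(la <- L) schur_coef la N a.
  by move=> clX expX N a; rewrite (class_Q_pattern a xt0 clX) (schur_expansion_sum a expX).
(* For [k > 2] a single Schur function is claimed only when [h = i], where the window has three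
   cells. *)
have [k_small|k_big] := leqP k 2.
  have [|X [clX [L expX L1]]] := small_k_pattern_expansion m_range size_C C_sorted perm_pat _ admissible_pat.
    by rewrite k_gt0.
  by exists L; split=> //; [case: expX | apply: use clX expX].
have [X [clX [L expX L1]]] := pattern_expansion m_range size_C C_sorted perm_pat k.
exists L; split; [by case: expX | | exact: use clX expX].
case=> // hi; apply/L1/short_bounds3; rewrite size_C hi subnn //.
Qed.

End Window.

Theorem theorem5p3 (k : nat) (mu : 'I_k -> seq nat * seq nat) :
  0 < k -> (forall i : 'I_k, is_skew_shape (mu i)) ->
  weak_dual_equivalence (size (cells_of mu)) (SYT mu) (DesSYT mu) (D_op mu) /\
  (k <= 2 ->
   dual_equivalence (size (cells_of mu)) (SYT mu) (DesSYT mu) (D_op mu)).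
Proof.
move=> k_gt0 mu_skew.
have single h i : 1 < h -> h <= i -> i < size (cells_of mu) -> i - h <= 3 -> h = i \/ k <= 2 ->
    forall x : seq_sub (SYT mu), is_schur (i - h + 3) (class_Q (DesSYT mu) (D_op mu) h i x).
  move=> h1 hi im ih hk x.
  have [L [Lp /(_ hk)]] := window_schur k_gt0 mu_skew h1 hi im ih (ssvalP x) erefl.
  case: L Lp => [|la [|la' L]] //= /andP[/andP[pla /eqP sla] _] _ LE.
  by exists la; do ![split=> //] => N a; rewrite LE big_seq1.
have weak : weak_dual_equivalence (size (cells_of mu)) (SYT mu) (DesSYT mu) (D_op mu).
  split; [|split].
  - by move=> i i_range x xS; split; [apply: D_op_SYT | apply: D_op_involutive].
  - move=> h i h1 hi im ih x; split=> [|h_eq]; last by apply: single => //; left.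
    have [L [Lp _ LE]] := window_schur k_gt0 mu_skew h1 hi im ih (ssvalP x) erefl.
    by exists L.
  by move=> i j i_range j_range ij x xS; apply: D_op_comm.
split=> // k_le2; split=> // h i h1 hi im ih x.
by apply: single => //; right.
Qed.
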